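(* Let $(\Omega,\mathcal F,\mu)$ be a finite measure space, $p\in[1,\infty)$ and $f\in L^p(\Omega,\mathcal F,\mu)$. Let $\mathfrak a_f\le\mathfrak b_f$ be the endpoints of the convex support of the distribution $\mu_f=\mu\circ f^{-1}$. Assume $\mu_f$ has a density $\Psi$ with respect to Lebesgue measure with $\Psi>0$ on $(\mathfrak a_f,\mathfrak b_f)$ and $\Psi=0$ outside. For $s\in(0,\mathfrak b_f-\mathfrak a_f)$ let $G_s:(\mathfrak a_f,\mathfrak b_f)\to[0,\infty)$, $G_s(y)=\Psi(y+s)/\Psi(y)$, and assume every $G_s$ is nonincreasing. Assume moreover one of: (H1) $\mathfrak a_f$ or $\mathfrak b_f$ is finite; (H2) for every $s\in(0,\mathfrak b_f-\mathfrak a_f)$, $G_s((\mathfrak a_f,\mathfrak b_f))$ is an infinite set; (H3) $\Psi$ is continuous. Then for every $k\ge1$ there is a unique minimizer of $\|f-g\|_p$ over $g\in\mathscr G_{p,k}$ (unique as an element of $L^p$).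
   Context: $\mathscr G_{p,k}$ is the set of functions $\sum_{i=1}^l a_i\mathbf 1_{A_i}\in L^p$ with $l\le k$, $\{A_i\}$ a measurable partition of $\Omega$, $a_i\in\mathbb R$. The cumulative distribution function is $F_f(x)=\mu(f^{-1}((-\infty,x]))$, and $\mathfrak a_f=\sup\{z:F_f(z)=0\}$, $\mathfrak b_f=\inf\{z:F_f(z)=\mu(\Omega)\}$ (possibly infinite). *)

(* Defs.v *)
From HB Require Import structures.
From mathcomp Require Import all_boot all_order all_algebra.
From mathcomp Require Import all_classical all_reals all_analysis.
Set Implicit Arguments. Unset Strict Implicit. Unset Printing Implicit Defensive.
Import Order.TTheory GRing.Theory Num.Theory.
Local Open Scope classical_set_scope.
Local Open Scope ring_scope.

Section defs.
Context {d : measure_display} {T : measurableType d} {R : realType}.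
Variable mu : {measure set T -> \bar R}.

Definition cdf (f : T -> R) (x : R) : \bar R := mu (f @^-1` `]-oo, x]).

Definition afrak (f : T -> R) : \bar R :=
  ereal_sup [set z%:E | z in [set z : R | cdf f z = 0%E]].
Definition bfrak (f : T -> R) : \bar R :=
  ereal_inf [set z%:E | z in [set z : R | cdf f z = mu setT]].

Definition inLp (p : R) (g : T -> R) : Prop :=
  measurable_fun setT g /\ (Lnorm mu p%:E (EFin \o g) < +oo)%E.

Definition Gpk (p : R) (k : nat) (g : T -> R) : Prop :=
  inLp p g /\
  exists (l : nat) (A : 'I_l -> set T) (a : 'I_l -> R),
    [/\ (l <= k)%N,
        (forall i, measurable (A i)),
        (forall i j, i != j -> A i `&` A j = set0),
        \big[setU/set0]_(i < l) A i = setT &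
        g = (fun x => \sum_(i < l) a i * \1_(A i) x)].

Definition Gs (Psi : R -> R) (s y : R) : R := Psi (y + s) / Psi y.

End defs.

(* Main.v *)
(* Push the problem to the real line: a k-level approximation costs at least
the distortion of its set of values, with equality exactly when f is sent to a
nearest value, so one has to show that the code (set of at most k real points)
of least distortion is unique.

Existence: along a minimizing sequence each point has a subsequence that
converges or escapes to infinity; an escaping point may be replaced by
anything in the limit, and dominated convergence applies to the minimum of the
limiting distance and the distances along the sequence.

Uniqueness: an optimal code is stationary, that is, each point [c] satisfies
the first order condition that the integral of sg(x - c) |x - c|^(p-1) Psi(x)
over the cell of [c] vanishes. Given two stationary codes, let [s > 0] be the
largest displacement [c' i - c i]. Translating back by [s], the cell of [c' i]
lies to the left of the cell of [c i], and Psi(. + s) / Psi is nonincreasing,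
so the integrands of the two first order conditions are pointwise comparable;
as both integrals vanish, they agree. Hence the two cells are translates of
each other and the displacement is also maximal at the neighbours, so the
whole code is translated by [s] and Psi(. + s) / Psi is constant on every
cell. Each of (H1), (H2), (H3) rules this out. *)
Require Import Defs.
From HB Require Import structures.
From mathcomp Require Import all_boot all_order all_algebra.
From mathcomp Require Import all_classical all_reals all_analysis.
From mathcomp Require Import measurable_realfun ring lra.
Set Implicit Arguments. Unset Strict Implicit. Unset Printing Implicit Defensive.
Import Order.TTheory GRing.Theory Num.Theory numFieldNormedType.Exports.
Local Open Scope classical_set_scope.
Local Open Scope ring_scope.

(** * Integration preliminaries: the equality case of monotonicity *)

Lemma le_integral_ae_eq d (T : measurableType d) (R : realType)
    (mu : {measure set T -> \bar R}) (h1 h2 : T -> R) :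
  mu.-integrable setT (EFin \o h1) -> mu.-integrable setT (EFin \o h2) ->
  (forall x, h1 x <= h2 x) ->
  (\int[mu]_x (h2 x)%:E <= \int[mu]_x (h1 x)%:E)%E ->
  {ae mu, forall x, h1 x = h2 x}.
Proof.
move=> i1 i2 h12 le21.
(* The difference is nonnegative with integral at most 0, hence zero almost everywhere. *)
have i3 : mu.-integrable setT (EFin \o (fun x => h2 x - h1 x)).
  by apply: eq_integrable (integrableB measurableT i2 i1) => //.
have E0 : (\int[mu]_x (h2 x - h1 x)%:E = 0)%E.
  apply/eqP; rewrite eq_le; apply/andP; split; last first.
    by apply: integral_ge0 => x _; rewrite lee_fin subr_ge0.
  rewrite [leLHS](_ : _ = \int[mu]_x (((EFin \o h2) \- (EFin \o h1)) x))%E//.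
  rewrite integralB// leeBlDr ?add0e//.
  exact: integrable_fin_num.
have : ae_eq mu setT (EFin \o (fun x => h2 x - h1 x)) (cst 0%E).
  apply/ae_eq_integral_abs => //; first by case/integrableP : i3.
  by rewrite -[RHS]E0; apply: eq_integral => x _; rewrite /= ger0_norm// subr_ge0.
by apply: filterS => x /= /(_ I)[] /subr0_eq.
Qed.

(** * Lebesgue measure: translation invariance and dense equality *)

Section lebesgue_toolbox.
Context {R : realType}.
Implicit Types h : R -> R.
Local Notation leb := (@lebesgue_measure R).

Lemma measurable_shift (s : R) : measurable_fun setT (fun x : R => x + s).
Proof. exact: measurable_funD. Qed.

(** Lebesgue measure is determined by its values on the intervals []a, b]], whose length a
    translation preserves. *)
Lemma lebesgue_measure_shift (s : R) (A : set R) : measurable A ->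
  pushforward leb (fun x : R => x + s : measurableTypeR R) A = leb A.
Proof.
move=> mA; apply/esym/lebesgue_measure_unique => //=.
  exact: measurable_shift.
move=> mshift _ [[a b]] _ <-; rewrite /pushforward/=.
have -> : (fun x : R => x + s) @^-1` `]a, b] = `]a - s, b - s]%classic.
  by apply/seteqP; split=> x; rewrite /= !in_itv/= ltrBlDr lerBrDr.
by rewrite !lebesgue_measure_itv/= !lte_fin ltrD2r -!EFinD opprD opprK addrACA addNr addr0.
Qed.

Lemma ge0_integral_shift (s : R) (F : R -> \bar R) : measurable_fun setT F ->
  (forall x, 0 <= F x)%E ->
  (\int[leb]_x F (x + s)%R = \int[leb]_x F x)%E.
Proof.
move=> mF F0.
have ms : measurable_fun setT (fun x : measurableTypeR R => x + s : measurableTypeR R).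
  exact: measurable_shift.
transitivity (\int[pushforward leb (fun x : R => (x + s)%R : measurableTypeR R)]_x F x)%E.
  by rewrite (ge0_integral_pushforward ms)//= => x _; exact: F0.
apply: eq_measure_integral => //= A mA _.
exact: lebesgue_measure_shift.
Qed.

Lemma integral_shift (s : R) h : measurable_fun setT h ->
  (\int[leb]_x (h (x + s)%R)%:E = \int[leb]_x (h x)%:E)%E.
Proof.
move=> mh; have mE : measurable_fun setT (EFin \o h) by exact/measurable_EFinP.
rewrite [LHS]integralE [RHS]integralE.
congr (_ - _)%E.
  rewrite [RHS](_ : _ = \int[leb]_x (EFin \o h)^\+%E x)%E//.
  rewrite -(ge0_integral_shift s (measurable_funepos mE)); last exact: funepos_ge0.
  by apply: eq_integral => x _; rewrite !funeposE.
rewrite [RHS](_ : _ = \int[leb]_x (EFin \o h)^\-%E x)%E//.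
rewrite -(ge0_integral_shift s (measurable_funeneg mE)); last exact: funeneg_ge0.
by apply: eq_integral => x _; rewrite !funenegE.
Qed.

Lemma integrable_shift (s : R) h : leb.-integrable setT (EFin \o h) ->
  leb.-integrable setT (EFin \o (fun x => h (x + s))).
Proof.
move=> ih; have /integrableP[mh fh] := ih.
apply/integrableP; split.
  exact: (measurableT_comp mh (measurable_shift s)).
have := @ge0_integral_shift s (abse \o (EFin \o h)).
by move=> /= ->//; exact: measurableT_comp.
Qed.

Lemma ae_dense (P : R -> Prop) : {ae leb, forall x, P x} ->
  forall x y, x < y -> exists2 z, x < z < y & P z.
Proof.
move=> [N [mN N0 PN]] x y xy; apply: contrapT => nz.
have : (leb `]x, y[%classic <= leb N)%E.
  apply: le_measure; rewrite ?inE//=.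
  move=> z; rewrite /= in_itv/= => xzy; apply: PN => Pz; apply: nz.
  by exists z.
rewrite N0 lebesgue_measure_itv/= lte_fin xy -EFinD lee_fin subr_le0.
by rewrite leNgt xy.
Qed.

(** A null set contains no open interval, so an almost everywhere equality can be tested inside any
    chosen interval. The contradictions below each need just one such point. *)
Lemma le_integral_eq_dense h1 h2 :
  leb.-integrable setT (EFin \o h1) -> leb.-integrable setT (EFin \o h2) ->
  (forall x, h1 x <= h2 x) ->
  (\int[leb]_x (h2 x)%:E <= \int[leb]_x (h1 x)%:E)%E ->
  forall x y, x < y -> exists2 z, x < z < y & h1 z = h2 z.
Proof. by move=> i1 i2 h12 le21; apply: ae_dense; exact: le_integral_ae_eq. Qed.

End lebesgue_toolbox.

(** * Integration against a measure with a density *)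

Section density.
Context d (T : measurableType d) (R : realType).
Variables (lam nu : {measure set T -> \bar R}) (w : T -> R).
Hypothesis mw : measurable_fun setT w.
Hypothesis w0 : forall x, 0 <= w x.
Hypothesis nuE : forall B, measurable B -> nu B = (\int[lam]_(x in B) (w x)%:E)%E.

Import HBNNSimple.

(** Monotone convergence reduces the claim to simple functions, linearity reduces these to
    indicators, and there it is [nuE]. *)
Lemma ge0_integral_density (F : T -> \bar R) : measurable_fun setT F ->
  (forall x, 0 <= F x)%E ->
  (\int[nu]_x F x = \int[lam]_x (F x * (w x)%:E))%E.
Proof.
move=> mF F0.
have mwE : measurable_fun setT (EFin \o w) by exact/measurable_EFinP.
pose f_ := nnsfun_approx measurableT mF.
transitivity (limn (fun n => \int[nu]_x (f_ n x)%:E))%E.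
  rewrite -monotone_convergence//.
  - by apply: eq_integral => y _; apply/esym/cvg_lim => //; exact: cvg_nnsfun_approx.
  - by move=> n; exact/measurable_EFinP/measurable_funP.
  - by move=> n y _; rewrite lee_fin.
  - by move=> y _ m n mn; rewrite lee_fin; exact/lefP/nd_nnsfun_approx.
transitivity (limn (fun n => \int[lam]_x ((f_ n x)%:E * (w x)%:E)))%E; last first.
  rewrite -monotone_convergence//.
  - apply: eq_integral => y _; apply/cvg_lim => //.
    by apply: cvgeZr => //; exact: cvg_nnsfun_approx.
  - move=> n; apply: emeasurable_funM => //.
    exact/measurable_EFinP/measurable_funP.
  - by move=> n y _; rewrite mule_ge0// lee_fin.
  - move=> y _ m n mn; rewrite lee_wpmul2r// ?lee_fin//.
    exact/lefP/nd_nnsfun_approx.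
congr (limn _); apply/funext => n.
transitivity (\sum_(k \in range (f_ n))
    \int[nu]_x (k * \1_(f_ n @^-1` [set k]) x)%:E)%E.
  under eq_integral do rewrite fimfunE -fsumEFin//.
  rewrite ge0_integral_fsum//.
  - by move=> y; exact/measurable_EFinP/measurable_funM.
  - by move=> y x _; rewrite nnfun_muleindic_ge0.
transitivity (\sum_(k \in range (f_ n))
    \int[lam]_x ((k * \1_(f_ n @^-1` [set k]) x)%:E * (w x)%:E))%E; last first.
  rewrite -ge0_integral_fsum//.
  - apply: eq_integral => x _.
    rewrite [in RHS]fimfunE -fsumEFin// ge0_mule_fsuml// => r.
    by rewrite nnfun_muleindic_ge0.
  - move=> y; apply: emeasurable_funM => //.
    exact/measurable_EFinP/measurable_funM.
  - by move=> y x _; rewrite mule_ge0 ?nnfun_muleindic_ge0// lee_fin.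
apply: eq_fsbigr => r _.
rewrite integralZl_indic_nnsfun// integral_indic// setIT nuE//.
(* Taking the constant [r] out of the integral requires [0 <= r]; for [r < 0] the level set is
   empty. *)
have [r0|r0] := ltP r 0.
  rewrite (preimage_nnfun0 _ r0)// integral_set0 mule0; apply/esym.
  by apply: integral0_eq => x _; rewrite indicE in_set0 mulr0 mul0e.
rewrite -ge0_integralZl//=; [|exact: measurable_funTS|by move=> x _; rewrite lee_fin].
rewrite integral_mkcond; apply: eq_integral => x _.
rewrite patchE indicE; case: ifPn => _; rewrite ?mulr1 ?mulr0 ?mul0e//.
Qed.

End density.

(** * The power function and its one-sided slopes *)

Section power.
Context {R : realType}.
Implicit Types p x y t u v l : R.

(* Up to the factor [p], the derivative of [t |-> `|t| `^ p]; for [p = 1] this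
is the sign of [t]. *)
Definition dpow p t : R := Num.sg t * `|t| `^ (p - 1).

Lemma dpow_gt0 p t : 0 < t -> 0 < dpow p t.
Proof. by move=> t0; rewrite /dpow gtr0_sg// mul1r powR_gt0// normr_gt0 gt_eqF. Qed.

Lemma dpowN p t : dpow p (- t) = - dpow p t.
Proof. by rewrite /dpow sgrN normrN mulNr. Qed.

Lemma dpow_lt0 p t : t < 0 -> dpow p t < 0.
Proof. by move=> t0; rewrite -oppr_gt0 -dpowN dpow_gt0// oppr_gt0. Qed.

Lemma dpow0 p : dpow p 0 = 0.
Proof. by rewrite /dpow sgr0 mul0r. Qed.

Lemma dpow_ge0 p t : 0 <= t -> 0 <= dpow p t.
Proof. by rewrite le_eqVlt => /predU1P[<-|/(dpow_gt0 p)/ltW//]; rewrite dpow0. Qed.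

Lemma dpow_le0 p t : t <= 0 -> dpow p t <= 0.
Proof. by move=> t0; rewrite -oppr_ge0 -dpowN dpow_ge0// oppr_ge0. Qed.

Lemma le_dpow p t u : 1 <= p -> t <= u -> dpow p t <= dpow p u.
Proof.
move=> p1; wlog u0 : t u / 0 <= u.
  (* Oddness turns [t <= u < 0] into [0 < - u <= - t]. *)
  move=> H tu; have [/H->//|u0] := leP 0 u.
  by rewrite -lerN2 -!dpowN H ?lerN2// oppr_ge0 (le_trans tu)// ltW.
move=> tu; have [t0|t0] := ltP t 0.
  by rewrite (@le_trans _ _ 0)// ?dpow_ge0// ltW// dpow_lt0.
move: t0; rewrite le_eqVlt => /predU1P[<-|t0]; first by rewrite dpow0 dpow_ge0.
have ut0 := lt_le_trans t0 tu.
rewrite /dpow !gtr0_sg// !mul1r !gtr0_norm// ge0_ler_powR// ?nnegrE ?subr_ge0//.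
by rewrite ltW.
Qed.

Lemma dpow_mul p v : 1 <= p -> dpow p v * v = `|v| `^ p.
Proof.
move=> p1; rewrite /dpow mulrAC.
have -> : Num.sg v * v = `|v| by rewrite normrEsg.
by rewrite mulr_powRB1// (lt_le_trans _ p1).
Qed.

(* Young's inequality for [`|u|] and [`|v| `^ (p - 1)]. *)
Lemma powR_subgradient p u v : 1 <= p ->
  `|v| `^ p + p * dpow p v * (u - v) <= `|u| `^ p.
Proof.
move=> p1; have p0 : 0 < p by exact: lt_le_trans p1.
have young : p * (`|u| * `|v| `^ (p - 1)) <= `|u| `^ p + (p - 1) * `|v| `^ p.
  (* The conjugate exponent [p / (p - 1)] exists only for [1 < p]; for [p = 1] the claim is an
     equality. *)
  move: p1; rewrite le_eqVlt => /predU1P[<-|p1].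
    by rewrite subrr powRr0 mul0r addr0 mulr1 mul1r powRr1.
  have q0 : 0 < p - 1 by rewrite subr_gt0.
  have := @conjugate_powR _ `|u| (`|v| `^ (p - 1)) p (p / (p - 1)) (normr_ge0 _)
    (powR_ge0 _ _) p0 (divr_gt0 p0 q0).
  rewrite -powRrM (_ : (p - 1) * (p / (p - 1)) = p); last by field; rewrite gt_eqF.
  have -> : p^-1 + (p / (p - 1))^-1 = 1 by field; rewrite !gt_eqF.
  move=> /(_ erefl); rewrite -(ler_pM2l p0) => /le_trans; apply.
  rewrite le_eqVlt; apply/orP; left; apply/eqP; field; rewrite !gt_eqF//.
have h : dpow p v * u <= `|u| * `|v| `^ (p - 1).
  rewrite (le_trans (ler_norm _))// normrM mulrC ler_wpM2l//.
  rewrite /dpow normrM (ger0_norm (powR_ge0 _ _)) -[leRHS]mul1r ler_wpM2r ?powR_ge0//.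
  by rewrite normr_sg lern1 leq_b1.
rewrite mulrBr -(mulrA p _ v) dpow_mul// -mulrA.
move: (ler_wpM2l (ltW p0) h) young; set A := `|v| `^ p; set B := `|u| `^ p; lra.
Qed.

(** The exponent [p - 1] lies between 0 and [p], so one term of the bound serves for [t] in the unit
    interval and the other outside it. This gives integrable majorants for first order
    conditions. *)
Lemma dpow_le_powR p t : 1 <= p -> `|dpow p t| <= 1 + `|t| `^ p.
Proof.
move=> p1; rewrite /dpow normrM normr_sg (ger0_norm (powR_ge0 _ _)).
apply: (@le_trans _ _ (`|t| `^ (p - 1))).
  by rewrite ler_piMl ?powR_ge0// lern1 leq_b1.
have [t1|t1] := leP `|t| 1.
  apply: (@le_trans _ _ 1); last by rewrite lerDl powR_ge0.
  have e1 : 1 = 1 `^ (p - 1) :> R by rewrite powR1.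
  by rewrite [leRHS]e1 ge0_ler_powR// ?nnegrE ?subr_ge0.
apply: (@le_trans _ _ (`|t| `^ p)); last by rewrite lerDr.
by rewrite ler_powR ?(ltW t1)// gerBl.
Qed.

Lemma powR_dist_le p x y : 1 <= p ->
  `|x - y| `^ p <= 2 `^ p * (`|x| `^ p + `|y| `^ p).
Proof.
move=> p1; have p0 : 0 <= p by exact: le_trans p1.
wlog xy : x y / `|x| <= `|y|.
  move=> H; have [/H//|/ltW/H h] := leP `|x| `|y|.
  by rewrite distrC (addrC (`|x| `^ p)).
apply: (@le_trans _ _ ((2 * `|y|) `^ p)).
  rewrite ge0_ler_powR ?nnegrE ?mulr_ge0//.
  by rewrite (le_trans (ler_normB _ _))// mulr_natl mulr2n lerD2r.
by rewrite powRM// ler_wpM2l ?powR_ge0// lerDr powR_ge0.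
Qed.

Lemma measurable_dpow p : measurable_fun setT (dpow p).
Proof.
have mpow : measurable_fun setT (fun t : R => `|t| `^ (p - 1)).
  apply: (measurableT_comp (measurable_powR (p - 1))).
  exact: normr_measurable.
have -> : dpow p = fun t => if 0 < t then `|t| `^ (p - 1)
                            else if t < 0 then - `|t| `^ (p - 1) else 0.
  apply/funext => t; rewrite /dpow; case: (ltgtP t 0) => t0.
  - by rewrite ltr0_sg// mulN1r.
  - by rewrite gtr0_sg// mul1r.
  - by rewrite t0 sgr0 mul0r.
apply: measurable_fun_ifT => //; first exact: measurable_fun_ltr.
apply: measurable_fun_ifT => //; first exact: measurable_fun_ltr.
exact: measurableT_comp.
Qed.

Lemma powR_cvg p (u : R^nat) l : 0 < l -> u @ \oo --> l ->
  (u n `^ p) @[n --> \oo] --> l `^ p.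
Proof.
move=> l0 ul.
suff c : {for l, continuous (fun t : R => t `^ p)} by have := cvg_comp _ _ ul c.
apply: differentiable_continuous; apply/derivable1_diffP.
by apply: derivable_powR; rewrite in_itv/= l0.
Qed.

(** The case [l = 0] is excluded because for [p = 1] the function is the sign, which jumps at 0. *)
Lemma dpow_cvg p (u : R^nat) l : l != 0 -> u @ \oo --> l ->
  dpow p (u n) @[n --> \oo] --> dpow p l.
Proof.
wlog l0 : u l / 0 < l.
  move=> H l0; have [l0'|l0'] := ltP 0 l; first exact: H.
  move=> ul; have := H (fun n => - u n) (- l).
  rewrite oppr_gt0 lt_neqAle oppr_eq0 l0 l0' => /(_ isT isT).
  move=> /(_ (cvgN ul)) /cvgN; rewrite dpowN opprK; apply: cvg_trans.
  apply: near_eq_cvg; near=> n; by rewrite /GRing.opp/= dpowN opprK.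
move=> _ ul; have := @powR_cvg (p - 1) _ _ l0 ul.
rewrite /dpow gtr0_sg// mul1r gtr0_norm//; apply: cvg_trans.
apply: near_eq_cvg; near=> n.
have un : 0 < u n by near: n; exact: (cvgr_gt l).
by rewrite gtr0_sg// mul1r gtr0_norm.
Unshelve. all: by end_near. Qed.

End power.

(** * Elementary facts on the real line *)

Lemma finite_range_continuous_cst {R : realType} (g : R -> R) :
  continuous g -> finite_set (range g) -> forall x y, g x = g y.
Proof.
move=> cg fing.
suff mono x y : g x <= g y by move=> x y; apply/eqP; rewrite eq_le !mono.
rewrite leNgt; apply/negP => yx.
(* By the intermediate value theorem the range contains an interval of positive length, whereas a
   finite set is null. *)
have sub : `](g y), (g x)[ `<=` range g.
  move=> v; rewrite /= in_itv/= => /andP[yv vx].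
  have [z _ zE] : exists2 z, z \in `[Num.min x y, Num.max x y] & g z = v.
    apply: IVT.
    - by rewrite ge_min !le_max !lexx.
    - exact/continuous_subspaceT.
    - case: (leP x y) => _; rewrite ge_min le_max !(ltW yv) !(ltW vx) ?orbT//=.
  by exists z.
have := finite_set_countable (sub_finite_set sub fing).
move=> /countable_lebesgue_measure0 /eqP.
rewrite lebesgue_measure_itv/= lte_fin yx -EFinD eqe subr_eq0.
by rewrite gt_eqF.
Qed.

Lemma exists_real_below {R : realType} (u : \bar R) (y : R) : (u < y%:E)%E ->
  exists2 x, (u < x%:E)%E & x < y.
Proof.
case: u => [r|//|_]; last by exists (y - 1); rewrite ?ltNyr ?ltrBlDr ?ltrDl.
by rewrite lte_fin => ry; exists ((r + y) / 2); rewrite ?lte_fin midf_lt.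
Qed.

Lemma exists_real_above {R : realType} (y : R) (v : \bar R) : (y%:E < v)%E ->
  exists2 x, y < x & (x%:E < v)%E.
Proof.
case: v => [r|_|//]; last by exists (y + 1); rewrite ?ltry ?ltrDl.
by rewrite lte_fin => ry; exists ((y + r) / 2); rewrite ?lte_fin midf_lt.
Qed.

(** * Codes, distance to a code, and limits of codes *)

Section codes.
Context {R : realType}.
Implicit Types (n : nat) (c : nat -> R) (x : R).

(** A code is a sequence of which only the indices up to [n] count: it has [n.+1] points, possibly
    repeated, and is never empty. *)
Fixpoint code_dist n c x : R :=
  if n is m.+1 then Num.min (code_dist m c x) `|x - c n| else `|x - c 0%N|.

Lemma code_dist_le n c x i : (i <= n)%N -> code_dist n c x <= `|x - c i|.
Proof.
elim: n => [|n IH]; first by rewrite leqn0 => /eqP ->.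
rewrite leq_eqVlt => /predU1P[->|]; rewrite /= ge_min ?lexx ?orbT//.
by rewrite ltnS => /IH ->.
Qed.

Lemma code_dist_attained n c x : exists2 i, (i <= n)%N & code_dist n c x = `|x - c i|.
Proof.
elim: n => [|n [i le_in E]]; first by exists 0%N.
rewrite /=; case: leP => _; first by exists i => //; exact: leqW.
by exists n.+1.
Qed.

Lemma le_code_dist n c x t : (forall i, (i <= n)%N -> t <= `|x - c i|) ->
  t <= code_dist n c x.
Proof. by move=> h; have [i le_in ->] := code_dist_attained n c x; exact: h. Qed.

Lemma code_dist_ge0 n c x : 0 <= code_dist n c x.
Proof. exact: le_code_dist. Qed.

Lemma code_dist_sub n m c c' x :
  (forall i, (i <= n)%N -> exists2 j, (j <= m)%N & c i = c' j) ->
  code_dist m c' x <= code_dist n c x.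
Proof. by move=> h; apply: le_code_dist => i /h[j jm ->]; exact: code_dist_le. Qed.

Lemma measurable_dist (t : R) : measurable_fun setT (fun x : R => `|x - t|).
Proof. by apply: measurableT_comp => //; exact: measurable_funB. Qed.

Lemma measurable_code_dist n c : measurable_fun setT (code_dist n c).
Proof.
elim: n => [|n IH]; first exact: measurable_dist.
exact: measurable_minr IH (measurable_dist _).
Qed.

(** A measurable choice of a nearest code point; the strict comparison gives ties to the smallest
    index. *)
Fixpoint nearest n c x : R :=
  if n is m.+1 then if `|x - c n| < code_dist m c x then c n else nearest m c x
  else c 0%N.

Lemma nearest_in n c x : exists2 i, (i <= n)%N & nearest n c x = c i.
Proof.
elim: n => [|n [i le_in E]]; first by exists 0%N.
by rewrite /=; case: ifP => _; [exists n.+1|exists i => //; exact: leqW].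
Qed.

Lemma dist_nearest n c x : `|x - nearest n c x| = code_dist n c x.
Proof. by elim: n => //= n IH; rewrite minC /Num.min; case: ifP. Qed.

Lemma measurable_nearest n c : measurable_fun setT (nearest n c).
Proof.
elim: n => [|n IH]; first exact: measurable_cst.
apply: measurable_fun_ifT => //.
by apply: measurable_fun_ltr; [exact: measurable_dist|exact: measurable_code_dist].
Qed.

(* Either [u] has a convergent subsequence, or [`|u|] tends to infinity along
a subsequence and any [l] will do. The bounded sequence [u / (1 + `|u|)]
treats both cases at once. *)
Lemma escaping_subsequence (u : R^nat) : exists2 g : nat -> nat, increasing_seq g &
  exists l : R, forall x e, 0 < e -> \forall m \near \oo, `|x - l| - e <= `|x - u (g m)|.
Proof.
pose v n := u n / (1 + `|u n|).
have den0 (t : R) : 0 < 1 + `|t| by rewrite ltr_pwDl.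
have vE n : `|v n| = `|u n| / (1 + `|u n|).
  by rewrite normrM normfV (gtr0_norm (den0 _)).
have v1 n : `|v n| < 1 by rewrite vE ltr_pdivrMr// mul1r ltrDr.
have bv : bounded_fun v.
  exists 1; split=> // M M1 n _; exact: (le_trans (ltW (v1 n)) (ltW M1)).
have [g gincr /cvg_ex[/= lam vlam]] := bolzano_weierstrass bv.
exists g => //; have [lam1|lam1] := ltP `|lam| 1.
  (* Away from modulus 1 the map [t / (1 - |t|)] is continuous and recovers [u] from [v], so
     [u \o g] converges. *)
  have uE n : u n = v n / (1 - `|v n|).
    rewrite vE /v; have := den0 (u n); set A := 1 + _ => A0.
    have -> : 1 - `|u n| / A = A^-1.
      by rewrite -[X in X - _](@divff _ A) ?gt_eqF// -mulrBl /A addrK mul1r.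
    by rewrite invrK divfK// gt_eqF.
  exists (lam / (1 - `|lam|)) => x e e0.
  have : (v \o g) m / (1 - `|(v \o g) m|) @[m --> \oo] --> lam / (1 - `|lam|).
    apply: cvgM => //; apply: cvgV; first by rewrite subr_eq0 gt_eqF.
    by apply: cvgB; [exact: cvg_cst|exact: cvg_norm].
  move=> /cvgrPdist_le/(_ e e0); apply: filterS => m /=; rewrite -uE => h.
  have := ler_distD (u (g m)) x (lam / (1 - `|lam|)).
  by rewrite (distrC (u (g m)) (lam / _)); move: h; lra.
(* Here [|u (g m)|] tends to infinity. Once it exceeds [2 * |x|], the point [u (g m)] is farther
   from [x] than 0 is, so [l = 0] will do. *)
exists 0 => x e e0; pose A := 2 * `|x|.
have A0 : 0 < 1 + A by rewrite ltr_pwDl// mulr_ge0.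
have Alam : A / (1 + A) < `|lam|.
  by rewrite (lt_le_trans _ lam1)// ltr_pdivrMr// mul1r ltrDr.
have : \forall m \near \oo, A / (1 + A) < `|(v \o g) m|.
  exact: (cvgr_norm_gt _ vlam).
apply: filterS => m /=.
rewrite vE ltr_pdivrMr// mulrAC ltr_pdivlMr// => h.
have Au : A < `|u (g m)| by move: h; set w := `|u (g m)|; nra.
rewrite subr0; have := ler_distD x (u (g m)) 0.
by rewrite !subr0 (distrC _ x); move: Au; rewrite /A; lra.
Qed.

Lemma le_increasing_seq (g : nat -> nat) m : increasing_seq g -> (m <= g m)%N.
Proof.
move=> /increasing_seqP gincr; elim: m => // m IH.
exact: leq_ltn_trans IH (gincr m).
Qed.

(** Subsequences are extracted one coordinate at a time; an eventual bound survives a further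
    extraction because an increasing [h] satisfies [m <= h m]. *)
Lemma escaping_code_subsequence n (cs : nat -> nat -> R) :
  exists2 g : nat -> nat, increasing_seq g & exists l : nat -> R,
  forall i, (i <= n)%N -> forall x e, 0 < e ->
    \forall m \near \oo, `|x - l i| - e <= `|x - cs (g m) i|.
Proof.
elim: n => [|n [g gincr [l lP]]].
  have [g gincr [l lP]] := escaping_subsequence (fun m => cs m 0%N).
  by exists g => //; exists (fun=> l) => i; rewrite leqn0 => /eqP ->.
have [h hincr [l' l'P]] := escaping_subsequence (fun m => cs (g m) n.+1).
exists (g \o h); first by move=> i j /=; rewrite gincr; exact: hincr.
exists (fun i => if i == n.+1 then l' else l i) => i.
rewrite leq_eqVlt => /predU1P[->|]; first by rewrite eqxx.
rewrite ltnS => le_in x e e0; rewrite ltn_eqF ?ltnS//.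
have [N _ NP] := lP i le_in x e e0; exists N => // m /= Nm.
by apply: NP; rewrite /= (leq_trans Nm)// le_increasing_seq.
Qed.

Lemma code_dist_lower_limit n (cs : nat -> nat -> R) (l : nat -> R) :
  (forall i, (i <= n)%N -> forall x e, 0 < e ->
    \forall m \near \oo, `|x - l i| - e <= `|x - cs m i|) ->
  forall x e, 0 < e -> \forall m \near \oo, code_dist n l x - e <= code_dist n (cs m) x.
Proof.
elim: n => [|n IH] lP x e e0; first exact: lP.
have h1 := IH (fun i le_in => lP i (leqW le_in)) x e e0.
have h2 := lP n.+1 (leqnn _) x e e0.
near=> m; rewrite /= le_min !lerBlDr; apply/andP; split.
  by rewrite ge_min -lerBlDr; apply/orP; left; near: m.
by rewrite ge_min -[X in _ || X]lerBlDr; apply/orP; right; near: m.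
Unshelve. all: by end_near. Qed.

End codes.

(** * The approximation problem on the line, for a density with monotone ratios *)

Section logconcave_density.
Context {R : realType}.
Local Notation leb := (@lebesgue_measure R).
Variables (a b : \bar R) (Psi : R -> R) (p : R).

(** Extended endpoints cover both a possibly unbounded support and the unbounded end cells of a
    code. *)
Definition inside (u v : \bar R) (x : R) : bool := (u < x%:E < v)%E.

(* The ratio [Psi (x + s) / Psi x] is nonincreasing, cleared of denominators
so that it also makes sense off the support. *)
Definition shift_monotone : Prop := forall x y s : R, x <= y -> 0 <= s ->
  Psi (y + s) * Psi x <= Psi (x + s) * Psi y.

Hypothesis p1 : 1 <= p.
Hypothesis mPsi : measurable_fun setT Psi.
Hypothesis Psi_gt0 : forall x, inside a b x -> 0 < Psi x.
Hypothesis Psi_eq0 : forall x, ~~ inside a b x -> Psi x = 0.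
Hypothesis Psi_shift : shift_monotone.
Hypothesis iPsi : leb.-integrable setT (EFin \o Psi).
Hypothesis iPsip : leb.-integrable setT (EFin \o (fun x => `|x| `^ p * Psi x)).

Lemma Psi_ge0 x : 0 <= Psi x.
Proof. by have [/Psi_gt0/ltW//|/Psi_eq0->] := boolP (inside a b x). Qed.

Lemma inside_between u v x y z : inside u v x -> inside u v z -> x <= y <= z ->
  inside u v y.
Proof.
move=> /andP[ux _] /andP[_ zv] /andP[xy yz]; apply/andP; split.
  by rewrite (lt_le_trans ux)// lee_fin.
by rewrite (le_lt_trans _ zv)// lee_fin.
Qed.

Lemma measurable_inside (u v : \bar R) : measurable [set x : R | inside u v x].
Proof.
have -> : [set x : R | inside u v x] =
    [set x | (u < x%:E)%E] `&` [set x | (x%:E < v)%E].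
  by apply/seteqP; split=> x /andP.
rewrite -[X in measurable (X `&` _)]setTI -[X in measurable (_ `&` X)]setTI.
apply: measurableI.
  exact: emeasurable_fun_o_infty.
exact: emeasurable_fun_infty_o.
Qed.

Lemma integrable_le_mulPsi (h k : R -> R) : measurable_fun setT h ->
  (forall x, `|h x| <= k x) -> leb.-integrable setT (EFin \o (fun x => k x * Psi x)) ->
  leb.-integrable setT (EFin \o (fun x => h x * Psi x)).
Proof.
move=> mh hk; apply: le_integrable => //.
  by apply/measurable_EFinP; exact: measurable_funM.
move=> x _; rewrite /= lee_fin normrM [leRHS]ger0_norm.
  by rewrite (ger0_norm (Psi_ge0 x)) ler_wpM2r ?Psi_ge0.
by rewrite mulr_ge0 ?Psi_ge0// (le_trans _ (hk x)).
Qed.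

Lemma integrable_affine (A B : R) :
  leb.-integrable setT (EFin \o (fun x => (A + B * `|x| `^ p) * Psi x)).
Proof.
have := integrableD measurableT (integrableZl measurableT A iPsi)
  (integrableZl measurableT B iPsip).
by apply: eq_integrable => // x _; rewrite /= -!EFinM -EFinD mulrDl mulrA.
Qed.

Lemma measurable_dist_powR (c : R) : measurable_fun setT (fun x : R => `|x - c| `^ p).
Proof.
apply: (measurableT_comp (measurable_powR p)).
by apply: measurableT_comp => //; exact: measurable_funB.
Qed.

Lemma integrable_powR (c : R) :
  leb.-integrable setT (EFin \o (fun x => `|x - c| `^ p * Psi x)).
Proof.
have := integrable_affine (2 `^ p * `|c| `^ p) (2 `^ p).
apply: integrable_le_mulPsi; first exact: measurable_dist_powR.
move=> x; rewrite ger0_norm ?powR_ge0// -mulrDr [X in _ <= _ * X]addrC.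
exact: (powR_dist_le _ _ p1).
Qed.

(** Up to the factor [- p], the derivative in [c] of the cost [|x - c| ^ p] on the cell from [u] to
    [v], weighted by the density. *)
Definition cell_gradient (u v : \bar R) (c x : R) : R :=
  (if inside u v x then dpow p (x - c) else 0) * Psi x.

Definition stationary (u v : \bar R) (c : R) : Prop :=
  (\int[leb]_x (cell_gradient u v c x)%:E = 0)%E.

Lemma measurable_cell_dpow u v c :
  measurable_fun setT (fun x : R => if inside u v x then dpow p (x - c) else 0).
Proof.
apply: measurable_fun_ifT => //.
  apply: (@measurable_fun_bool _ _ _ _ true); rewrite setTI.
  exact: measurable_inside.
apply: (measurableT_comp (measurable_dpow p)).
exact: measurable_funB.
Qed.

Lemma integrable_cell_gradient u v c :
  leb.-integrable setT (EFin \o cell_gradient u v c).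
Proof.
have := integrable_affine (1 + 2 `^ p * `|c| `^ p) (2 `^ p).
apply: integrable_le_mulPsi; first exact: measurable_cell_dpow.
move=> x; apply: (@le_trans _ _ (1 + `|x - c| `^ p)).
  case: ifPn => _; first exact: dpow_le_powR.
  by rewrite normr0 addr_ge0 ?powR_ge0.
rewrite -addrA lerD2l -mulrDr [X in _ <= _ * X]addrC.
exact: (powR_dist_le _ _ p1).
Qed.

(** * Comparison of two stationary cells, the second shifted back by [s] *)

Section compare.
Variables (u v u' v' : \bar R) (c c' s : R).
Hypotheses (s0 : 0 <= s) (cI : inside a b c) (cI' : inside a b c').
Hypotheses (cuv : inside u v c) (cuv' : inside u' v' c').
Hypotheses (uu' : (u' <= u + s%:E)%E) (vv' : (v' <= v + s%:E)%E) (cc' : c + s <= c').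
Hypotheses (st : stationary u v c) (st' : stationary u' v' c').

Let left_in x : (u < x%:E)%E -> (u' < (x + s)%:E)%E.
Proof. by move=> ux; rewrite (le_lt_trans uu')// EFinD lteD2rE. Qed.

Let right_in x : ((x + s)%:E < v')%E -> (x%:E < v)%E.
Proof. by move=> /lt_le_trans/(_ vv'); rewrite EFinD lteD2rE. Qed.

(** The factors [Psi c] and [Psi (c + s)] normalise the ratio at [c], exactly where [dpow p (x - c)]
    changes sign: to the right a nonnegative factor meets a smaller ratio, to the left a nonpositive
    factor meets a larger one. If only [x] lies in its cell, then [x] is to the right of [c] and the
    right-hand side is nonnegative; if only [x + s] does, it is to the left of [c'] and the
    left-hand side is nonpositive. *)
Let pointwise x : cell_gradient u' v' c' (x + s) * Psi c <=
                  cell_gradient u v c x * Psi (c + s).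
Proof.
have Pp := Psi_ge0; rewrite /cell_gradient.
have [in'|nin'] := boolP (inside u' v' (x + s)); last first.
  rewrite !mul0r; have [/andP[ux xv]|_] := boolP (inside u v x); last by rewrite !mul0r.
  apply: mulr_ge0 (Pp _); apply: mulr_ge0 (Pp _).
  rewrite dpow_ge0// subr_ge0 -(lerD2r s) (le_trans cc')//.
  rewrite ltW// -lte_fin; case/andP: cuv' => _ /lt_le_trans; apply.
  by move: nin'; rewrite /inside left_in//= -leNgt.
have [ins|nin] := boolP (inside u v x).
  have le_d : dpow p (x + s - c') <= dpow p (x - c).
    by rewrite le_dpow// -(lerD2r c') subrK; move: cc'; lra.
  apply: (@le_trans _ _ (dpow p (x - c) * (Psi (x + s) * Psi c))).
    by rewrite -mulrA ler_wpM2r// mulr_ge0.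
  rewrite -mulrA; have [cx|xc] := leP c x.
    apply: ler_wpM2l; first by rewrite dpow_ge0// subr_ge0.
    by rewrite [leRHS]mulrC Psi_shift.
  apply: ler_wnM2l; first by rewrite dpow_le0// subr_le0 ltW.
  by rewrite mulrC Psi_shift// ltW.
rewrite !mul0r; apply: mulr_le0_ge0 (Pp _); apply: mulr_le0_ge0 (Pp _).
rewrite dpow_le0// subr_le0.
apply: le_trans cc'; rewrite lerD2r ltW// -lte_fin.
case/andP: cuv => uc _; apply: le_lt_trans uc.
case/andP: in' => _ xv; move: nin; rewrite /inside (right_in xv) andbT.
by rewrite -leNgt.
Qed.

(** Stationarity and translation invariance make both integrals zero, so the pointwise inequality is
    an equality on a dense set. *)
Lemma compare_dense x y : x < y -> exists2 z, x < z < y &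
  cell_gradient u' v' c' (z + s) * Psi c = cell_gradient u v c z * Psi (c + s).
Proof.
move: x y; apply: le_integral_eq_dense => //.
- have := integrableZr measurableT (Psi c) (integrable_shift s (integrable_cell_gradient u' v' c')).
  by apply: eq_integrable => // x _ /=; rewrite EFinM.
- have := integrableZr measurableT (Psi (c + s)) (integrable_cell_gradient u v c).
  by apply: eq_integrable => // x _ /=; rewrite EFinM.
under eq_integral do rewrite EFinM.
rewrite integralZr//; last exact: integrable_cell_gradient.
under [leRHS]eq_integral do rewrite EFinM.
rewrite integralZr//; last exact: (integrable_shift s (integrable_cell_gradient u' v' c')).
rewrite st integral_shift ?st' ?mul0e//.
have /integrableP[+ _] := integrable_cell_gradient u' v' c'.
by move/measurable_EFinP.
Qed.

(** Otherwise a point [z] of equality lies between [c] and [c' - s]; there the gradient at [z + s]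
    is negative and the one at [z] nonnegative. *)
Lemma compare_center : c' = c + s.
Proof.
apply/eqP; rewrite eq_le cc' andbT leNgt; apply/negP => lt_cc'.
have : c < c' - s by rewrite ltrBrDr.
move=> /compare_dense[z /andP[cz]]; rewrite ltrBrDr => zc'.
have zin' : inside u' v' (z + s).
  apply/andP; split; last by case/andP: cuv' => _; apply: lt_trans; rewrite lte_fin.
  by apply: left_in; case/andP: cuv => uc _; apply: lt_trans uc _; rewrite lte_fin.
have zin : inside u v z.
  apply/andP; split; last by case/andP: zin' => _ /right_in.
  by case/andP: cuv => uc _; apply: lt_trans uc _; rewrite lte_fin.
have zI : inside a b (z + s).
  by apply: (inside_between cI cI'); rewrite (ltW zc') andbT; move: s0 cz; lra.
rewrite /cell_gradient zin zin' => E.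
have : dpow p (z + s - c') * Psi (z + s) * Psi c < 0.
  by rewrite -mulrA pmulr_llt0 ?dpow_lt0 ?subr_lt0// mulr_gt0 ?Psi_gt0.
rewrite E ltNge => /negP; apply.
apply: mulr_ge0 (Psi_ge0 _); apply: mulr_ge0 (Psi_ge0 _).
by rewrite dpow_ge0// subr_ge0 ltW.
Qed.

(** Otherwise some [z] of equality lies between [r' - s] and [r]: it is outside the first cell, so
    one side is zero, while [z + s] is in the second cell, left of [c'] and in the support, so the
    other side is negative. *)
Lemma compare_left r r' : u = r%:E -> u' = r'%:E -> inside a b r' -> r' = r + s.
Proof.
move=> ur ur' r'I; apply/eqP; rewrite eq_le; apply/andP; split.
  by move: uu'; rewrite ur ur' -EFinD lee_fin.
rewrite leNgt; apply/negP => lt_r.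
have : r' - s < r by rewrite ltrBlDr.
move=> /compare_dense[z /andP[]]; rewrite ltrBlDr => r'z zr.
have rc : r < c by move: cuv; rewrite /inside ur lte_fin => /andP[].
have zc' : z + s < c' by rewrite compare_center ltrD2r (lt_trans zr).
have zin' : inside u' v' (z + s).
  rewrite /inside ur' lte_fin r'z/=; case/andP: cuv' => _; apply: lt_trans.
  by rewrite lte_fin.
have zI : inside a b (z + s) by apply: (inside_between r'I cI'); rewrite !ltW.
rewrite /cell_gradient zin' /inside ur lte_fin ltNge (ltW zr)/= !mul0r => /eqP.
by rewrite -mulrA lt_eqF// pmulr_llt0 ?dpow_lt0 ?subr_lt0// mulr_gt0 ?Psi_gt0.
Qed.

(** The mirror image: between [r' - s] and [r] the point [z] is in the first cell, right of [c], and
    [z + s] has left the second one. *)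
Lemma compare_right r r' : v = r%:E -> v' = r'%:E -> inside a b r -> r' = r + s.
Proof.
move=> vr vr' rI; apply/eqP; rewrite eq_le; apply/andP; split.
  by move: vv'; rewrite vr vr' -EFinD lee_fin.
rewrite leNgt; apply/negP => lt_r.
have : r' - s < r by rewrite ltrBlDr.
move=> /compare_dense[z /andP[]]; rewrite ltrBlDr => r'z zr.
have rc' : c' < r' by move: cuv'; rewrite /inside vr' lte_fin => /andP[].
have cz : c < z by rewrite -(ltrD2r s) -compare_center (lt_trans rc').
have zin : inside u v z.
  rewrite /inside vr lte_fin zr andbT; case/andP: cuv => uc _.
  by apply: lt_trans uc _; rewrite lte_fin.
have zI : inside a b z by apply: (inside_between cI rI); rewrite !ltW.
rewrite /cell_gradient zin -compare_center /inside vr' !lte_fin.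
rewrite [X in _ && X]ltNge (ltW r'z) andbF !mul0r => /esym/eqP.
by rewrite /= -mulrA gt_eqF// mulr_gt0 ?dpow_gt0 ?subr_gt0// mulr_gt0 ?Psi_gt0.
Qed.

Lemma compare_ratio x y : u' = (u + s%:E)%E -> v' = (v + s%:E)%E -> x < y ->
  exists2 z, x < z < y & inside u v z -> Psi (z + s) * Psi c = Psi (c + s) * Psi z.
Proof.
(* The factor [dpow p (z - c)] to be cancelled vanishes at [z = c], so the interval is first shrunk
   to avoid [c]. *)
move=> eu ev xy; wlog nc : x y xy / ~~ (x < c < y).
  move=> H; have [/andP[xc cy]|nc] := boolP (x < c < y); last exact: H.
  have [|z /andP[xz zc] zP] := H x c xc; first by rewrite ltxx andbF.
  by exists z => //; rewrite xz (lt_trans zc).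
have [z xzy E] := compare_dense xy; exists z => // zin; move: E.
have zin' : inside u' v' (z + s) by rewrite /inside eu ev EFinD !lteD2rE.
rewrite /cell_gradient zin zin' compare_center/=.
rewrite (_ : z + s - (c + s) = z - c); last by ring.
rewrite -mulrA -[RHS]mulrA (mulrC (Psi z)) => E.
have d0 : dpow p (z - c) != 0.
  have [zc|zc|zc] := ltgtP z c.
  - by rewrite lt_eqF// dpow_lt0// subr_lt0.
  - by rewrite gt_eqF// dpow_gt0// subr_gt0.
  - by move: nc; rewrite -zc xzy.
exact: (mulfI d0 E).
Qed.

End compare.


(** * Voronoi cells and stationary codes *)

Definition cell_lb (c : nat -> R) (i : nat) : \bar R :=
  if i is j.+1 then ((c j + c i) / 2)%:E else -oo%E.

Definition cell_ub (n : nat) (c : nat -> R) (i : nat) : \bar R :=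
  if i == n then +oo%E else ((c i + c i.+1) / 2)%:E.

(** The strict order fixes the labelling, so that two codes can be compared index by index. *)
Definition stationary_code (n : nat) (c : nat -> R) : Prop :=
  [/\ forall i, (i <= n)%N -> inside a b (c i),
      forall i, (i < n)%N -> c i < c i.+1 &
      forall i, (i <= n)%N -> stationary (cell_lb c i) (cell_ub n c i) (c i)].

Lemma inside_cell n c i : (forall i, (i < n)%N -> c i < c i.+1) -> (i <= n)%N ->
  inside (cell_lb c i) (cell_ub n c i) (c i).
Proof.
move=> cincr le_in; rewrite /inside /cell_ub; apply/andP; split.
  case: i le_in => [|i] le_in; first by rewrite ltNyr.
  by rewrite /cell_lb lte_fin midf_lt// cincr.
case: eqVneq => [_|i_n]; first by rewrite ltry.
by rewrite lte_fin midf_lt// cincr// ltn_neqAle i_n.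
Qed.

Lemma mid_inside n (c : nat -> R) j : stationary_code n c -> (j < n)%N ->
  inside a b ((c j + c j.+1) / 2).
Proof.
move=> [h1 h2 _] jn; apply: (inside_between (h1 _ (ltnW jn)) (h1 _ jn)).
by rewrite !midf_le// ltW// h2.
Qed.

(** * Propagation of a maximal displacement along the code *)

Section shifted_code.
Variables (n : nat) (c c' : nat -> R) (s : R).
Hypotheses (s0 : 0 <= s) (stc : stationary_code n c) (stc' : stationary_code n c').

Section at_maximal_shift.
Hypothesis le_s : forall j, (j <= n)%N -> c' j <= c j + s.
Variable i : nat.
Hypotheses (le_in : (i <= n)%N) (eq_i : c' i = c i + s).

Let cIn := let: And3 h _ _ := stc in h.
Let cIn' := let: And3 h _ _ := stc' in h.
Let cincr := let: And3 _ h _ := stc in h.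
Let cincr' := let: And3 _ h _ := stc' in h.
Let cstat := let: And3 _ _ h := stc in h.
Let cstat' := let: And3 _ _ h := stc' in h.

(** A midpoint moves by the mean of two displacements, here one equal to [s] and one at most [s]. *)
Let lb_le : (cell_lb c' i <= cell_lb c i + s%:E)%E.
Proof.
case: i le_in eq_i => [|j] jn eqj //=; rewrite -EFinD lee_fin.
by have := le_s (ltnW jn); rewrite eqj; lra.
Qed.

Let ub_le : (cell_ub n c' i <= cell_ub n c i + s%:E)%E.
Proof.
rewrite /cell_ub; case: eqVneq => [//|i_n].
have /le_s : (i < n)%N by rewrite ltn_neqAle i_n.
by rewrite -EFinD lee_fin eq_i; lra.
Qed.

(** By [compare_left] the midpoint below [c i] moves by exactly [s]; since [c i] does so too, its
    left neighbour must. *)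
Lemma shift_pred j : i = j.+1 -> c' j = c j + s.
Proof.
move=> ij; have jn : (j < n)%N by rewrite -ij.
have := compare_left s0 (cIn le_in) (cIn' le_in)
  (inside_cell cincr le_in) (inside_cell cincr' le_in) lb_le ub_le _
  (cstat le_in) (cstat' le_in).
rewrite eq_i lexx => /(_ isT ((c j + c i) / 2) ((c' j + c' i) / 2)).
rewrite ij => /(_ erefl erefl (mid_inside stc' jn)).
by rewrite -ij eq_i; lra.
Qed.

Lemma shift_succ : (i < n)%N -> c' i.+1 = c i.+1 + s.
Proof.
move=> lt_in.
have := compare_right s0 (cIn le_in) (cIn' le_in)
  (inside_cell cincr le_in) (inside_cell cincr' le_in) lb_le ub_le _
  (cstat le_in) (cstat' le_in).
rewrite eq_i lexx => /(_ isT ((c i + c i.+1) / 2) ((c' i + c' i.+1) / 2)).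
rewrite /cell_ub ltn_eqF// => /(_ erefl erefl (mid_inside stc lt_in)).
by rewrite eq_i; lra.
Qed.

End at_maximal_shift.

(* At an index where the displacement [c' i - c i] is maximal, the cell of
[c'] is the translate of the cell of [c] by that displacement; hence the
neighbouring displacements are maximal too. *)
Lemma constant_shift i : (forall j, (j <= n)%N -> c' j <= c j + s) ->
  (i <= n)%N -> c' i = c i + s -> forall j, (j <= n)%N -> c' j = c j + s.
Proof.
move=> le_s le_in eq_i.
have down k : (k <= i)%N -> c' (i - k)%N = c (i - k)%N + s.
  elim: k => [|k IH] ki; first by rewrite subn0.
  apply: (shift_pred le_s _ (IH (ltnW ki))); last by rewrite -subSn// subSS.
  by rewrite (leq_trans (leq_subr _ _)).
have up k : (i + k <= n)%N -> c' (i + k)%N = c (i + k)%N + s.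
  elim: k => [|k IH] ki; first by rewrite addn0.
  rewrite addnS in ki *.
  exact: (shift_succ le_s (ltnW ki) (IH (ltnW ki)) ki).
move=> j jn; have [ji|/ltnW ij] := leqP j i.
  by have := down (i - j)%N (leq_subr _ _); rewrite subKn.
by have := up (j - i)%N; rewrite subnKC//; apply.
Qed.

Lemma shift_ratio : (forall j, (j <= n)%N -> c' j = c j + s) ->
  forall i, (i <= n)%N -> forall x y, x < y -> exists2 z, x < z < y &
    inside (cell_lb c i) (cell_ub n c i) z ->
    Psi (z + s) * Psi (c i) = Psi (c i + s) * Psi z.
Proof.
move=> eq_s i le_in x y xy.
have [cIn cincr cstat] := stc; have [cIn' cincr' cstat'] := stc'.
have eql : cell_lb c' i = (cell_lb c i + s%:E)%E.
  case: i le_in => [//|j] jn /=; rewrite !eq_s ?(ltnW jn)// -EFinD.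
  by congr _%:E; lra.
have equ : cell_ub n c' i = (cell_ub n c i + s%:E)%E.
  rewrite /cell_ub; case: eqVneq => [//|i_n].
  have lt_in : (i < n)%N by rewrite ltn_neqAle i_n.
  by rewrite !eq_s// -EFinD; congr _%:E; lra.
apply: (compare_ratio s0 (cIn i le_in) (cIn' i le_in) (inside_cell cincr le_in)
  (inside_cell cincr' le_in) _ _ _ (cstat i le_in) (cstat' i le_in)) => //.
- by rewrite eql.
- by rewrite equ.
- by rewrite eq_s.
Qed.

End shifted_code.

(** * Consequences of a positive translation between stationary codes *)

Section no_translate.
Variables (n : nat) (c c' : nat -> R) (s : R).
Hypotheses (s0 : 0 < s) (stc : stationary_code n c) (stc' : stationary_code n c').
Hypothesis eq_s : forall j, (j <= n)%N -> c' j = c j + s.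

Let cIn := let: And3 h _ _ := stc in h.
Let cincr := let: And3 _ h _ := stc in h.
Let cIn' := let: And3 h _ _ := stc' in h.
Let ratio := shift_ratio (ltW s0) stc stc' eq_s.

(** Just below a finite [b], in the last cell, [Psi (z + s)] is zero, whereas the constant ratio on
    that cell is positive. *)
Lemma translate_upper_infinite : b \isn't a fin_num.
Proof.
apply/negP => bfin.
have /andP[acn cnb] := cIn (leqnn n).
move: cnb; rewrite -(fineK bfin) lte_fin => cnb.
have : Num.max (c n) (fine b - s) < fine b.
  by rewrite gt_max cnb ltrBlDr ltrDl.
move=> /(ratio (leqnn n))[z /andP[]]; rewrite gt_max => /andP[cz bz] zb.
have zin : inside (cell_lb c n) (cell_ub n c n) z.
  have /andP[lc _] := inside_cell cincr (leqnn n).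
  by rewrite /inside (lt_trans lc) ?lte_fin//= /cell_ub eqxx ltry.
have zI : inside a b z.
  by rewrite /inside (lt_trans acn) ?lte_fin//= -(fineK bfin) lte_fin.
move=> /(_ zin)/eqP; rewrite (@Psi_eq0 (z + s)) ?mul0r; last first.
  apply/negP => /andP[_]; rewrite -(fineK bfin) lte_fin -ltrBrDr.
  by move=> /(lt_trans bz); rewrite ltxx.
by rewrite eq_sym gt_eqF// mulr_gt0 ?Psi_gt0// -eq_s ?cIn'.
Qed.

(** Just below a finite [a], in the first cell, [Psi z] is zero but [Psi (z + s)] is not. *)
Lemma translate_lower_infinite : a \isn't a fin_num.
Proof.
apply/negP => afin.
have /andP[ac0 _] := cIn (leq0n n).
move: ac0; rewrite -(fineK afin) lte_fin => ac0.
have : fine a - s < fine a by rewrite ltrBlDr ltrDl.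
move=> /(ratio (leq0n n))[z /andP[az za]].
have zin : inside (cell_lb c 0) (cell_ub n c 0) z.
  have /andP[_ cu] := inside_cell cincr (leq0n n).
  by rewrite /inside ltNyr/= (lt_trans _ cu)// lte_fin (lt_trans za).
have zsI : inside a b (z + s).
  have /andP[_] := cIn' (leq0n n); rewrite eq_s// => c'b.
  rewrite /inside (lt_trans _ c'b) ?lte_fin ?ltrD2r ?(lt_trans za)// andbT.
  by rewrite -(fineK afin) lte_fin -ltrBlDr.
move=> /(_ zin)/eqP; rewrite (@Psi_eq0 z) ?mulr0; last first.
  by rewrite /inside -(fineK afin) lte_fin ltNge (ltW za).
by rewrite gt_eqF// mulr_gt0 ?Psi_gt0// cIn.
Qed.

Lemma translate_ends_infinite : a = -oo%E /\ b = +oo%E.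
Proof.
have /andP[] := cIn (leq0n n).
have := translate_upper_infinite; have := translate_lower_infinite.
by case: a => [r| |]; case: b => [r'| |].
Qed.

Let insideT x : inside a b x.
Proof.
by rewrite /inside; have [-> ->] := translate_ends_infinite; rewrite ltNyr ltry.
Qed.

Lemma translate_Gs_nonincreasing x y : x <= y -> Gs Psi s y <= Gs Psi s x.
Proof.
move=> xy; rewrite /Gs ler_pdivrMr ?Psi_gt0// mulrAC ler_pdivlMr ?Psi_gt0//.
exact: Psi_shift (ltW s0).
Qed.

(** The ratio is known to equal its value at the center only on a dense set; being nonincreasing, it
    is squeezed at [y] between two such points. *)
Lemma translate_Gs_cell i y : (i <= n)%N -> inside (cell_lb c i) (cell_ub n c i) y ->
  Gs Psi s y = Gs Psi s (c i).
Proof.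
move=> le_in /andP[ly yu].
have eqG z : (inside (cell_lb c i) (cell_ub n c i) z ->
    Psi (z + s) * Psi (c i) = Psi (c i + s) * Psi z) ->
    inside (cell_lb c i) (cell_ub n c i) z -> Gs Psi s z = Gs Psi s (c i).
  move=> zP zin; apply/eqP; rewrite /Gs eqr_div ?lt0r_neq0 ?Psi_gt0//.
  by apply/eqP; exact: zP.
have [x lx xy] := exists_real_below ly.
have [x' yx' x'u] := exists_real_above yu.
have [z /andP[xz zy] /eqG zE] := ratio le_in xy.
have [z' /andP[yz z'x'] /eqG z'E] := ratio le_in yx'.
apply/eqP; rewrite eq_le; apply/andP; split.
  rewrite -zE ?translate_Gs_nonincreasing ?(ltW zy)//.
  by rewrite /inside (lt_trans lx) ?lte_fin//= (lt_trans _ yu) ?lte_fin.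
rewrite -z'E ?translate_Gs_nonincreasing ?(ltW yz)//.
by rewrite /inside (lt_trans ly) ?lte_fin//= (lt_trans _ x'u) ?lte_fin.
Qed.

Lemma cell_cover y : exists2 i, (i <= n)%N &
  inside (cell_lb c i) (cell_ub n c i) y \/ y = (c i + c i.+1) / 2.
Proof.
(* The cells are scanned from left to right: [y] is still beyond the lower end of cell [m], or has
   already been located. *)
suff H m : (m <= n)%N -> (cell_lb c m < y%:E)%E \/ (exists2 i, (i <= n)%N &
    inside (cell_lb c i) (cell_ub n c i) y \/ y = (c i + c i.+1) / 2).
  have [//|ly|//] := H n; exists n => //; left.
  by rewrite /inside ly /cell_ub eqxx ltry.
elim: m => [_|m IH mn]; first by left; rewrite ltNyr.
have [|ly|] := IH; [exact: ltnW| |by right].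
have [ym|my|ym] := ltgtP y ((c m + c m.+1) / 2).
- right; exists m; [exact: ltnW|left].
  by rewrite /inside ly /cell_ub ltn_eqF// lte_fin.
- by left; rewrite /= lte_fin.
- by right; exists m; [exact: ltnW|right].
Qed.

(** There is one value per cell and one per midpoint. This refutes (H2), and under (H3) makes the
    ratio constant. *)
Lemma translate_Gs_finite : finite_set (range (Gs Psi s)).
Proof.
apply: (@sub_finite_set _ _ ((fun i => Gs Psi s (c i)) @` `I_n.+1 `|`
    (fun i => Gs Psi s ((c i + c i.+1) / 2)) @` `I_n.+1)); last first.
  by rewrite finite_setU; split; apply: finite_image; exact: finite_II.
move=> _ [y _ <-]; have [i le_in [yin|->]] := cell_cover y.
- by left; exists i => //=; rewrite -(translate_Gs_cell le_in yin).
- by right; exists i.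
Qed.

Lemma integrable_halfline (t k : R) : leb.-integrable setT
  (EFin \o (fun x => (if x < t then k else 0) * Psi x)).
Proof.
have := integrable_affine `|k| 0; apply: integrable_le_mulPsi.
  by apply: measurable_fun_ifT => //; exact: measurable_fun_ltr.
by move=> x; rewrite mul0r addr0; case: ifP; rewrite ?normr0.
Qed.

Lemma translate_Gs_not_constant : ~ (forall x y, Gs Psi s x = Gs Psi s y).
Proof.
move=> G_cst; pose K := Gs Psi s 0.
have K0 : 0 < K by rewrite /K /Gs divr_gt0// Psi_gt0.
have PsiK x : Psi (x + s) = K * Psi x.
  by rewrite /K (G_cst 0 x) /Gs divfK// gt_eqF// Psi_gt0.
have iK : leb.-integrable setT (EFin \o (fun x => K * Psi x)).
  have := integrable_affine K 0; apply: eq_integrable => // x _.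
  by rewrite /= mul0r addr0.
have intK : (\int[leb]_x (K * Psi x)%:E = \int[leb]_x (Psi x)%:E)%E.
  by rewrite -(integral_shift s mPsi); apply: eq_integral => x _; rewrite PsiK.
(* [Psi] and [K * Psi] have the same integral and are ordered pointwise, so they agree somewhere,
   where [Psi] is positive. *)
have K1 : K = 1.
  have PsiI z : Psi z != 0 by rewrite gt_eqF// Psi_gt0.
  have [K1|K1] := leP K 1.
    have [||z _ E] := le_integral_eq_dense iK iPsi _ _ (@ltr01 R).
    - by move=> x; rewrite ler_piMl ?Psi_ge0.
    - by rewrite intK.
    - by apply: (mulIf (PsiI z)); rewrite mul1r.
  have [||z _ E] := le_integral_eq_dense iPsi iK _ _ (@ltr01 R).
  - by move=> x; rewrite ler_peMl ?Psi_ge0// ltW.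
  - by rewrite intK.
  - by apply: (mulIf (PsiI z)); rewrite mul1r.
(* Now [Psi] has period [s], so the half-lines below [- s] and below 0 carry the same finite mass,
   although [Psi] is positive in between. *)
have sN0 : - s < 0 by rewrite oppr_lt0.
have [||z /andP[sz z0] E] := le_integral_eq_dense
  (integrable_halfline (- s) 1) (integrable_halfline 0 1) _ _ sN0.
- move=> x; apply: ler_wpM2r; first exact: Psi_ge0.
  by case: ifPn => xs; case: ifPn => // /negP; rewrite (lt_trans xs).
- rewrite -(integral_shift s); last first.
    by have /integrableP[/measurable_EFinP] := integrable_halfline 0 1.
  rewrite le_eqVlt; apply/orP; left; apply/eqP; apply: eq_integral => x _.
  by rewrite PsiK K1 mul1r -(opprK s) subr_lt0 opprK.
move: E; rewrite z0 ltNge (ltW sz)/= mul0r mul1r => /eqP.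
by rewrite eq_sym gt_eqF// Psi_gt0.
Qed.

End no_translate.

(** * Uniqueness of the stationary code *)

Hypothesis nondegenerate :
  [\/ a \is a fin_num \/ b \is a fin_num,
      (forall s : R, (0 < s%:E < b - a)%E ->
         infinite_set [set Gs Psi s y | y in [set y : R | (a < y%:E < b)%E]])
    | continuous Psi].

Lemma stationary_code_le n c c' : stationary_code n c -> stationary_code n c' ->
  forall i, (i <= n)%N -> c' i <= c i.
Proof.
move=> stc stc' i le_in; rewrite leNgt; apply/negP => lt_i.
(* Some displacement is positive by assumption, so the largest one, [s], is positive and
   [constant_shift] applies at the index [m]. *)
pose m := [arg max_(j > (ord0 : 'I_n.+1)) (c' j - c j)]%O.
have mmax : forall j : 'I_n.+1, c' j - c j <= c' m - c m.
  by rewrite /m; case: Order.TotalTheory.arg_maxP => //= k _ kmax j; exact: kmax.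
set s := c' m - c m in mmax.
have s0 : 0 < s.
  by rewrite (lt_le_trans _ (mmax (Ordinal (le_in : (i < n.+1)%N))))// subr_gt0.
have eq_s : forall j, (j <= n)%N -> c' j = c j + s.
  apply: (@constant_shift n c c' s (ltW s0) stc stc' m).
  - by move=> j jn; rewrite addrC -lerBlDr; exact: (mmax (Ordinal (jn : (j < n.+1)%N))).
  - by rewrite -ltnS.
  - by rewrite /s addrC subrK.
have [ea eb] := translate_ends_infinite s0 stc stc' eq_s.
case: nondegenerate => [[]|H2|H3].
- by rewrite ea.
- by rewrite eb.
- have := H2 s; rewrite lte_fin s0 ea eb /= ltry => /(_ isT); apply.
  apply: sub_finite_set (translate_Gs_finite s0 stc stc' eq_s).
  by move=> _ [y _ <-]; exists y.
apply: (translate_Gs_not_constant s0 stc stc' eq_s).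
apply: finite_range_continuous_cst (translate_Gs_finite s0 stc stc' eq_s).
move=> x; apply: cvgM.
  apply: (@cvg_comp _ _ _ (fun y => y + s) Psi); last exact: H3.
  by apply: cvgD; [exact: cvg_id|exact: cvg_cst].
apply: cvgV; last exact: H3.
by rewrite gt_eqF// Psi_gt0// /inside ea eb ltNyr ltry.
Qed.

Lemma stationary_code_unique n c c' : stationary_code n c -> stationary_code n c' ->
  forall i, (i <= n)%N -> c' i = c i.
Proof.
by move=> h h' i le_in; apply/eqP; rewrite eq_le !(@stationary_code_le n).
Qed.

(** * Existence of an optimal code *)

Definition distortion (n : nat) (c : nat -> R) : \bar R :=
  (\int[leb]_x (code_dist n c x `^ p * Psi x)%:E)%E.

Definition optimal_code (n : nat) (c : nat -> R) : Prop :=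
  forall c', (distortion n c <= distortion n c')%E.

Let p_ge0 : 0 <= p. Proof. exact: le_trans p1. Qed.

Lemma le_code_distp n c x t : code_dist n c x <= t -> code_dist n c x `^ p <= t `^ p.
Proof.
move=> h; rewrite ge0_ler_powR ?nnegrE ?code_dist_ge0//.
by rewrite (le_trans _ h)// code_dist_ge0.
Qed.

Lemma measurable_code_distp n c : measurable_fun setT (fun x => code_dist n c x `^ p).
Proof. exact: (measurableT_comp (measurable_powR p) (measurable_code_dist n c)). Qed.

Lemma integrable_code_dist n c :
  leb.-integrable setT (EFin \o (fun x => code_dist n c x `^ p * Psi x)).
Proof.
have := integrable_powR (c 0%N).
apply: integrable_le_mulPsi; first exact: measurable_code_distp.
by move=> x; rewrite ger0_norm ?powR_ge0// le_code_distp// code_dist_le.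
Qed.

Lemma distortion_fin_num n c : distortion n c \is a fin_num.
Proof. by apply: integrable_fin_num => //; exact: integrable_code_dist. Qed.

Lemma distortion_ge0 n c : (0 <= distortion n c)%E.
Proof. by apply: integral_ge0 => x _; rewrite lee_fin mulr_ge0 ?powR_ge0 ?Psi_ge0. Qed.

Lemma le_distortion n c c' : (forall x, code_dist n c x <= code_dist n c' x) ->
  (distortion n c <= distortion n c')%E.
Proof.
move=> h; apply: le_integral => //; try exact: integrable_code_dist.
by move=> x _; rewrite lee_fin ler_wpM2r ?Psi_ge0// le_code_distp.
Qed.

Lemma optimal_code_exists n : exists c, optimal_code n c.
Proof.
pose S := range (distortion n); pose D := ereal_inf S.
have D0 : (0 <= D)%E by apply: le_ereal_inf_tmp => _ [c _ <-]; exact: distortion_ge0.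
have Dfin : D \is a fin_num.
  rewrite ge0_fin_numE//; have := distortion_fin_num n (fun=> 0).
  rewrite ge0_fin_numE ?distortion_ge0//; apply: le_lt_trans.
  by apply: ereal_inf_lbound; exists (fun=> 0).
have near_inf m : exists c, (distortion n c < D + (m.+1%:R^-1)%:E)%E.
  have e0 : 0 < m.+1%:R^-1 :> R by rewrite invr_gt0.
  by have [_ [c _ <-] cD] := lb_ereal_inf_adherent e0 Dfin; exists c.
have [cs csP] := choice near_inf.
have [g gincr [l lP]] := escaping_code_subsequence n cs.
have {}lP := code_dist_lower_limit lP.
exists l => c'; apply: (@le_trans _ _ D); last by apply: ereal_inf_lbound; exists c'.
(* Truncating at the distance to the limit code provides a majorant, and the lower limit bound
   forces [E m x] to converge to that distance. *)
pose E m x := Num.min (code_dist n l x) (code_dist n (cs (g m)) x).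
have E_ge0 m x : 0 <= E m x by rewrite le_min !code_dist_ge0.
have mE m : measurable_fun setT (fun x => E m x `^ p * Psi x).
  apply: measurable_funM => //; apply: (measurableT_comp (measurable_powR p)).
  by apply: measurable_minr; exact: measurable_code_dist.
have Ecvg x : E m x `^ p @[m --> \oo] --> code_dist n l x `^ p.
  (* [powR_cvg] asks for a positive limit; at a zero limit [E m x] is constantly zero. *)
  have := code_dist_ge0 n l x; rewrite le_eqVlt => /predU1P[l0|l0].
    suff -> : (fun m => E m x `^ p) = fun=> code_dist n l x `^ p by exact: cvg_cst.
    apply/funext => m; congr (_ `^ p); apply/eqP; rewrite eq_le -{2}l0 E_ge0 andbT.
    by rewrite ge_min lexx.
  apply: powR_cvg => //; apply/cvgrPdist_le => e e0.
  have := lP x e e0; apply: filterS => m h; rewrite ger0_norm; last first.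
    by rewrite subr_ge0 ge_min lexx.
  by rewrite lerBlDr -lerBlDl le_min h gerBl ltW.
pose f_ m x : \bar R := (E m x `^ p * Psi x)%:E.
have lim_E : (\int[leb]_x f_ m x)%E @[m --> \oo] --> distortion n l.
  suff [] : [/\ leb.-integrable setT (EFin \o (fun x => code_dist n l x `^ p * Psi x)),
    (\int[leb]_x `|f_ m x - (EFin \o (fun x => code_dist n l x `^ p * Psi x)%R) x|)%E
      @[m --> \oo] --> 0%E &
    (\int[leb]_x f_ m x)%E @[m --> \oo] --> distortion n l] by [].
  apply: (@dominated_convergence _ _ _ leb setT measurableT f_ _
    (EFin \o (fun x => code_dist n l x `^ p * Psi x))).
  - by move=> m; apply/measurable_EFinP; exact: mE.
  - by apply/measurable_EFinP; apply: measurable_funM => //; exact: measurable_code_distp.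
  - apply: aeW => x _; apply: cvg_EFin; first exact: nearW.
    by apply: cvgMl; exact: Ecvg.
  - exact: integrable_code_dist.
  - apply: aeW => x m _; rewrite /= lee_fin ger0_norm ?mulr_ge0 ?powR_ge0 ?Psi_ge0//.
    rewrite ler_wpM2r ?Psi_ge0// ge0_ler_powR ?nnegrE ?code_dist_ge0 ?E_ge0//.
    by rewrite ge_min lexx.
apply/lee_addgt0Pr => e e0; apply: cvge_le lim_E.
near=> m; apply: (@le_trans _ _ (distortion n (cs (g m)))).
  apply: ge0_le_integral => //.
  - by move=> x _; rewrite lee_fin mulr_ge0 ?powR_ge0 ?Psi_ge0.
  - by apply/measurable_EFinP; exact: mE.
  - by apply/measurable_EFinP; apply: measurable_funM => //; exact: measurable_code_distp.
  move=> x _; rewrite lee_fin ler_wpM2r ?Psi_ge0// ge0_ler_powR ?nnegrE ?code_dist_ge0 ?E_ge0//.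
  by rewrite ge_min lexx orbT.
apply: le_trans (ltW (csP _)) _; rewrite leeD2l// lee_fin.
apply: (@le_trans _ _ m.+1%:R^-1).
  by rewrite lef_pV2 ?posrE// ler_nat ltnS le_increasing_seq.
by apply: ltW; near: m; exact: (near_infty_natSinv_lt (PosNum e0)).
Unshelve. all: by end_near. Qed.

(** * Every point of an optimal code is useful; description of the cells *)

Definition set_code (c : nat -> R) (i : nat) (y : R) (j : nat) : R :=
  if j == i then y else c j.

(** A point never strictly nearest on the support could be moved without loss to a support point [y]
    off the code, which would strictly lower the distortion near [y]. *)
Lemma optimal_code_useful n c i x0 : inside a b x0 -> optimal_code n c -> (i <= n)%N ->
  exists2 x, inside a b x & forall j, (j <= n)%N -> j != i -> `|x - c i| < `|x - c j|.
Proof.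
move=> x0I copt le_in; apply: contrapT => nuseful.
have useless x : inside a b x ->
    exists2 j, (j <= n)%N & j != i /\ `|x - c j| <= `|x - c i|.
  move=> xI; apply: contrapT => h; apply: nuseful; exists x => // j jn ji.
  by rewrite ltNge; apply/negP => hj; apply: h; exists j.
have [y yI dy] : exists2 y, inside a b y & 0 < code_dist n c y.
  apply: contrapT => h.
  have [_ /exists_real_above[x1 x01 x1b]] := andP x0I.
  (* If every support point were a code point, an interval would be contained in a finite set. *)
  have sub : `]x0, x1[ `<=` c @` `I_n.+1.
    move=> z; rewrite /= in_itv/= => /andP[x0z zx1].
    have zI : inside a b z.
      have [ax0 _] := andP x0I.
      by rewrite /inside (lt_trans ax0) ?lte_fin//= (lt_trans _ x1b) ?lte_fin.
    have [j jn dE] := code_dist_attained n c z.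
    exists j => //; apply/esym/eqP; rewrite -subr_eq0 -normr_le0 -dE leNgt.
    by apply/negP => dz; apply: h; exists z.
  have := finite_set_countable (sub_finite_set sub (finite_image _ (finite_II _))).
  move=> /countable_lebesgue_measure0 /eqP.
  by rewrite lebesgue_measure_itv/= lte_fin x01 -EFinD eqe subr_eq0 gt_eqF.
pose c2 := set_code c i y.
have c2_le x : inside a b x -> code_dist n c2 x <= code_dist n c x.
  move=> xI; have [j jn ->] := code_dist_attained n c x.
  have [ji|ji] := eqVneq j i; last first.
    by apply: le_trans (code_dist_le _ _ jn) _; rewrite /c2 /set_code (negbTE ji).
  have [k kn [ki]] := useless x xI; rewrite ji; apply: le_trans.
  by apply: le_trans (code_dist_le _ _ kn) _; rewrite /c2 /set_code (negbTE ki).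
have [_ /exists_real_above[x1 yx1 x1b]] := andP yI.
(* Within half the distance from [y] to the code, [y] is strictly nearer than any point of the
   code. *)
have ymin : y < Num.min x1 (y + code_dist n c y / 2).
  by rewrite lt_min yx1 ltrDl divr_gt0.
have [||z /andP[yz]] := le_integral_eq_dense (integrable_code_dist n c2)
    (integrable_code_dist n c) _ _ ymin.
- move=> x; have [xI|xI] := boolP (inside a b x); last by rewrite Psi_eq0// !mulr0.
  by rewrite ler_wpM2r ?Psi_ge0// le_code_distp// c2_le.
- exact: copt.
rewrite lt_min => /andP[zx1 zd] E.
have zI : inside a b z.
  have [ay _] := andP yI.
  by rewrite /inside (lt_trans ay) ?lte_fin//= (lt_trans _ x1b) ?lte_fin.
have lt_d : code_dist n c2 z < code_dist n c z.
  apply: (@le_lt_trans _ _ (z - y)).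
    apply: le_trans (code_dist_le _ _ le_in) _.
    by rewrite /c2 /set_code eqxx gtr0_norm// subr_gt0.
  have [j jn ->] := code_dist_attained n c z.
  have := code_dist_le c y jn; have := ler_distD z y (c j).
  by rewrite (distrC y z) (gtr0_norm (_ : 0 < z - y)) ?subr_gt0//; move: zd; lra.
have : code_dist n c2 z `^ p * Psi z < code_dist n c z `^ p * Psi z.
  rewrite ltr_pM2r ?Psi_gt0// gt0_ltr_powR ?nnegrE ?code_dist_ge0//.
  exact: lt_le_trans p1.
by rewrite E ltxx.
Qed.

Lemma increasing_code_le n (c : nat -> R) : (forall i, (i < n)%N -> c i < c i.+1) ->
  forall i j, (i <= j)%N -> (j <= n)%N -> c i <= c j.
Proof.
move=> cincr i; elim=> [|j IH]; first by rewrite leqn0 => /eqP ->.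
rewrite leq_eqVlt => /predU1P[->//|]; rewrite ltnS => ij jn.
by rewrite (le_trans (IH ij (ltnW jn)))// ltW// cincr.
Qed.

Lemma cell_nearest n (c : nat -> R) i x : (forall j, (j < n)%N -> c j < c j.+1) -> (i <= n)%N ->
  inside (cell_lb c i) (cell_ub n c i) x -> `|x - c i| <= code_dist n c x.
Proof.
move=> cincr le_in /andP[lx xu]; apply: le_code_dist => j jn.
have mono := increasing_code_le cincr.
have [ij|ji|->//] := ltngtP i j.
- have i_n : (i < n)%N by exact: leq_trans jn.
  have := mono i.+1 j ij jn; have := cincr i i_n.
  move: xu; rewrite /cell_ub ltn_eqF// lte_fin => xu ci cj.
  by rewrite ler_norml lerNl opprB; case: (lerP x (c j)) => h; apply/andP; split; lra.
- case: i ji le_in lx xu => [//|i]; rewrite ltnS => ji i_n; rewrite /= lte_fin => lx _.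
  have := mono j i ji (ltnW i_n); have := cincr i i_n => ci cj.
  by rewrite ler_norml lerNl opprB; case: (lerP (c j) x) => h; apply/andP; split; lra.
Qed.

Lemma outside_cell n (c : nat -> R) i x : (forall j, (j < n)%N -> c j < c j.+1) -> (i <= n)%N ->
  ~~ inside (cell_lb c i) (cell_ub n c i) x ->
  exists2 j, (j <= n)%N & j != i /\ `|x - c j| <= `|x - c i|.
Proof.
move=> cincr le_in; rewrite /inside negb_and -!leNgt => /orP[].
  case: i le_in => [//|i] i_n; rewrite /= lee_fin => xl.
  exists i; first exact: ltnW.
  split; first by rewrite ltn_eqF.
  have ci := cincr i i_n.
  rewrite [leRHS]ler0_norm; last by lra.
  by rewrite ler_norml; apply/andP; split; lra.
rewrite /cell_ub; case: eqVneq => [//|i_n]; rewrite lee_fin => ux.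
have {}i_n : (i < n)%N by rewrite ltn_neqAle i_n.
exists i.+1 => //; split; first by rewrite gtn_eqF.
have ci := cincr i i_n.
rewrite [leRHS]ger0_norm; last by lra.
by rewrite ler_norml; apply/andP; split; lra.
Qed.

(** * The first order condition at an optimal code *)

Section first_order.
Variables (n : nat) (c : nat -> R) (i : nat).
Hypotheses (copt : optimal_code n c) (le_in : (i <= n)%N).
Hypothesis cincr : forall j, (j < n)%N -> c j < c j.+1.
Let u := cell_lb c i.
Let v := cell_ub n c i.

Lemma integrable_cell_powR y : leb.-integrable setT
  (EFin \o (fun x => (if inside u v x then `|x - y| `^ p - `|x - c i| `^ p else 0) * Psi x)).
Proof.
have := integrableD measurableT (integrable_powR y) (integrable_powR (c i)).
have -> : ((EFin \o (fun x => `|x - y| `^ p * Psi x)%R) \+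
    (EFin \o (fun x => `|x - c i| `^ p * Psi x)%R))%E =
    EFin \o (fun x => (`|x - y| `^ p + `|x - c i| `^ p) * Psi x).
  by apply/funext => x; rewrite /= -EFinD mulrDl.
apply: integrable_le_mulPsi.
  apply: measurable_fun_ifT => //.
    apply: (@measurable_fun_bool _ _ _ _ true); rewrite setTI.
    exact: measurable_inside.
  by apply: measurable_funB; exact: measurable_dist_powR.
move=> x; case: ifPn => _; last by rewrite normr0 addr_ge0 ?powR_ge0.
by rewrite (le_trans (ler_normB _ _))// !(ger0_norm (powR_ge0 _ _)).
Qed.

(** Moving [c i] to [y] with the cells kept frozen costs at least the distortion of the moved code,
    which optimality bounds from below. *)
Lemma cell_center_optimal y : (0 <= \int[leb]_x
  ((if inside u v x then `|x - y| `^ p - `|x - c i| `^ p else 0) * Psi x)%R%:E)%E.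
Proof.
rewrite -(@leeD2lE _ (distortion n c)) ?distortion_fin_num// adde0.
rewrite /distortion -integralD//=; [|exact: integrable_code_dist|exact: integrable_cell_powR].
apply: le_trans (copt (set_code c i y)) _; apply: le_integral => //.
- exact: integrable_code_dist.
- exact: (integrableD measurableT (integrable_code_dist n c) (integrable_cell_powR y)).
move=> x _; rewrite /= -EFinD lee_fin -mulrDl ler_wpM2r ?Psi_ge0//.
have [xin|xout] := boolP (inside u v x).
  have := le_code_distp (code_dist_le (set_code c i y) x le_in).
  rewrite /set_code eqxx => h; apply: le_trans h _.
  suff : `|x - c i| `^ p <= code_dist n c x `^ p by lra.
  by rewrite ge0_ler_powR ?nnegrE ?code_dist_ge0// cell_nearest.
rewrite addr0 le_code_distp//; have [j jn ->] := code_dist_attained n c x.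
have [ji|ji] := eqVneq j i; last first.
  by apply: le_trans (code_dist_le _ _ jn) _; rewrite /set_code (negbTE ji).
have [k kn [ki]] := outside_cell cincr le_in xout; rewrite ji; apply: le_trans.
by apply: le_trans (code_dist_le _ _ kn) _; rewrite /set_code (negbTE ki).
Qed.

(** Integrating the subgradient inequality at [x - y] against the density avoids differentiating
    under the integral sign. *)
Lemma cell_gradient_sign y :
  (((y - c i)%:E * \int[leb]_x (cell_gradient u v y x)%:E) <= 0)%E.
Proof.
have ig := integrable_cell_gradient u v y.
rewrite -integralZl//.
have ig2 := integrableZl measurableT (y - c i) ig.
have p0 : 0 < p by exact: lt_le_trans p1.
rewrite -(@pmule_rle0 _ p%:E)// -oppe_ge0.
have -> : (- (p%:E * \int[leb]_x ((y - c i)%:E * (cell_gradient u v y x)%:E)))%E =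
   (\int[leb]_x ((- p)%R%:E * ((y - c i)%:E * (cell_gradient u v y x)%:E)))%E.
  by rewrite [RHS](integralZl measurableT ig2) EFinN mulNe.
apply: le_trans (cell_center_optimal y) _; apply: le_integral => //.
- exact: integrable_cell_powR.
- exact: (integrableZl measurableT (- p) ig2).
move=> x _; rewrite -!EFinM lee_fin /cell_gradient !mulrA ler_wpM2r ?Psi_ge0//.
case: ifPn => _; last by rewrite mulr0.
by have := powR_subgradient (x - c i) (x - y) p1; lra.
Qed.

Lemma cell_gradient_cvg (e : R^nat) : (forall m, `|e m| <= 1) -> e @ \oo --> 0 ->
  (\int[leb]_x (cell_gradient u v (c i + e m) x)%:E)%E @[m --> \oo] -->
  (\int[leb]_x (cell_gradient u v (c i) x)%:E)%E.
Proof.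
(* Since [|e m| <= 1], the centers [c i + e m] are bounded by [|c i| + 1], whence a majorant
   independent of [m]. *)
move=> e1 e0; pose K := 1 + 2 `^ p * (`|c i| + 1) `^ p.
pose f_ m := EFin \o cell_gradient u v (c i + e m).
suff [] : [/\ leb.-integrable setT (EFin \o cell_gradient u v (c i)),
    (\int[leb]_x `|f_ m x - (EFin \o cell_gradient u v (c i)) x|)%E @[m --> \oo] --> 0%E &
    (\int[leb]_x f_ m x)%E @[m --> \oo] -->
      (\int[leb]_x (cell_gradient u v (c i) x)%:E)%E] by [].
apply: (@dominated_convergence _ _ _ leb setT measurableT f_ _
   (EFin \o (fun x => (K + 2 `^ p * `|x| `^ p) * Psi x))).
- by move=> m; have /integrableP[] := integrable_cell_gradient u v (c i + e m).
- by have /integrableP[] := integrable_cell_gradient u v (c i).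
(* For [p = 1] pointwise convergence may fail at [x = c i], a null set. *)
- exists [set c i]; split; [exact: measurable_set1|exact: lebesgue_measure_set1|].
  move=> x /= h; apply: contrapT => xc; apply: h => _.
  apply: cvg_EFin; first exact: nearW.
  apply: cvgMl; case: (inside u v x); last exact: cvg_cst.
  apply: dpow_cvg; first by rewrite subr_eq0; apply/eqP.
  rewrite -[X in _ --> X]subr0; under eq_cvg do rewrite opprD addrA.
  by apply: cvgB => //; exact: cvg_cst.
- exact: integrable_affine.
apply: aeW => x m _; rewrite /= lee_fin normrM (ger0_norm (Psi_ge0 _)) ler_wpM2r ?Psi_ge0//.
apply: (@le_trans _ _ (1 + `|x - (c i + e m)| `^ p)).
  case: ifPn => _; first exact: dpow_le_powR.
  by rewrite normr0 addr_ge0 ?powR_ge0.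
rewrite -addrA lerD2l -mulrDr [X in _ <= _ * X]addrC.
apply: le_trans (powR_dist_le _ _ p1) _.
rewrite ler_wpM2l ?powR_ge0// lerD2l ge0_ler_powR ?nnegrE//.
by rewrite (le_trans (ler_normD _ _))// lerD2l.
Qed.

(** Approaching [c i] from the right and from the left along the harmonic sequence yields the two
    opposite inequalities. *)
Lemma cell_stationary : stationary u v (c i).
Proof.
have h1 m : `|@harmonic R m| <= 1.
  by rewrite ger0_norm ?harmonic_ge0// invf_le1// ler1n.
apply/eqP; rewrite eq_le; apply/andP; split.
  apply: cvge_le (cell_gradient_cvg h1 cvg_harmonic); apply: nearW => m.
  have := cell_gradient_sign (c i + harmonic m); rewrite addrAC subrr add0r.
  by rewrite pmule_rle0// lte_fin harmonic_gt0.
have h2 m : `|- @harmonic R m| <= 1 by rewrite normrN.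
have cvgN0 : (fun m => - @harmonic R m) @ \oo --> 0.
  by rewrite -oppr0; apply: cvgN; exact: cvg_harmonic.
apply: cvge_ge (cell_gradient_cvg h2 cvgN0); apply: nearW => m.
have := cell_gradient_sign (c i - harmonic m); rewrite addrAC subrr add0r.
by rewrite EFinN mulNe oppe_le0 pmule_rge0// lte_fin harmonic_gt0.
Qed.

End first_order.

(** * Optimal codes are stationary, hence unique *)

Lemma optimal_center_inside n (c : nat -> R) i x0 : inside a b x0 ->
  optimal_code n c -> (forall j, (j < n)%N -> c j < c j.+1) -> (i <= n)%N ->
  inside a b (c i).
Proof.
move=> x0I copt cincr le_in; apply: contrapT => /negP nI.
(* The cell of [c i] meets the support in an interval; were [c i] outside the support, the gradient
   would have a strict constant sign there, against stationarity. *)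
have [x xI xnear] := optimal_code_useful x0I copt le_in.
have xin : inside (cell_lb c i) (cell_ub n c i) x.
  apply: contrapT => /negP /(outside_cell cincr le_in)[j jn [ji]].
  by rewrite leNgt xnear.
have st := cell_stationary copt le_in cincr.
set u := cell_lb c i in xin st; set v := cell_ub n c i in xin st.
have [ax /exists_real_above[x1 xx1 x1b]] := andP xI.
have [ux /exists_real_above[x2 xx2 x2v]] := andP xin.
have xm : x < Num.min x1 x2 by rewrite lt_min xx1.
have zP z : x < z < Num.min x1 x2 -> inside a b z /\ inside u v z.
  rewrite lt_min => /and3P[xz zx1 zx2]; split.
    by rewrite /inside (lt_trans ax) ?lte_fin//= (lt_trans _ x1b) ?lte_fin.
  by rewrite /inside (lt_trans ux) ?lte_fin//= (lt_trans _ x2v) ?lte_fin.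
have i0 : leb.-integrable setT (EFin \o (fun=> 0 : R)).
  exact: integrable0.
have ig := integrable_cell_gradient u v (c i).
have int0 : (\int[leb]_x (0 : R)%:E = 0)%E by exact: integral0.
move: nI; rewrite /inside negb_and -!leNgt => /orP[ca|bc].
  have pos t : inside a b t -> inside u v t -> 0 < cell_gradient u v (c i) t.
    move=> tI tin; rewrite /cell_gradient tin mulr_gt0 ?Psi_gt0// dpow_gt0// subr_gt0.
    by have [at_ _] := andP tI; rewrite -lte_fin (le_lt_trans ca).
  have [||z /zP[zI zin] E] := le_integral_eq_dense i0 ig _ _ xm.
  - move=> t; have [tI|/Psi_eq0 t0] := boolP (inside a b t); last first.
      by rewrite /cell_gradient t0 mulr0.
    have [tin|tout] := boolP (inside u v t); first by rewrite ltW// pos.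
    by rewrite /cell_gradient (negbTE tout) mul0r.
  - by rewrite st int0.
  by have := pos z zI zin; rewrite -E ltxx.
have neg t : inside a b t -> inside u v t -> cell_gradient u v (c i) t < 0.
  move=> tI tin; rewrite /cell_gradient tin pmulr_llt0 ?Psi_gt0// dpow_lt0// subr_lt0.
  by have [_ tb] := andP tI; rewrite -lte_fin (lt_le_trans tb).
have [||z /zP[zI zin] E] := le_integral_eq_dense ig i0 _ _ xm.
- move=> t; have [tI|/Psi_eq0 t0] := boolP (inside a b t); last first.
    by rewrite /cell_gradient t0 mulr0.
  have [tin|tout] := boolP (inside u v t); first by rewrite ltW// neg.
  by rewrite /cell_gradient (negbTE tout) mul0r.
- by rewrite st int0.
by have := neg z zI zin; rewrite E ltxx.
Qed.

Lemma sorted_code n (c : nat -> R) : exists c' : nat -> R,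
  (forall i, (i < n)%N -> c' i <= c' i.+1) /\
  (forall i, (i <= n)%N -> exists2 j, (j <= n)%N & c i = c' j).
Proof.
pose s := [seq c i | i <- iota 0 n.+1]; pose s' := sort <=%R s.
have ss' : size s' = n.+1 by rewrite size_sort size_map size_iota.
exists (nth 0 s'); split.
  move=> i i_n; have := sort_sorted (@le_total _ R) s.
  by move=> /(sortedP 0); apply; rewrite -/s' ss' ltnS.
move=> i le_in; have : c i \in s' by rewrite mem_sort map_f// mem_iota.
by move=> /(nthP 0)[j]; rewrite ss' ltnS => jn <-; exists j.
Qed.

Lemma optimal_stationary n c x0 : inside a b x0 -> optimal_code n c ->
  exists c', [/\ optimal_code n c', stationary_code n c' &
    forall i, (i <= n)%N -> exists2 j, (j <= n)%N & c i = c' j].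
Proof.
move=> x0I copt; have [c' [c'le cc']] := sorted_code n c.
have c'opt : optimal_code n c'.
  by move=> c2; apply: le_trans (copt c2); apply: le_distortion => x; exact: code_dist_sub.
have c'incr i : (i < n)%N -> c' i < c' i.+1.
  move=> i_n; rewrite lt_neqAle c'le// andbT; apply/eqP => E.
  (* Of two equal points neither is ever strictly nearest. *)
  have [x _ /(_ i.+1 i_n)] := optimal_code_useful x0I c'opt (ltnW i_n).
  by rewrite gtn_eqF// E ltxx => /(_ isT).
exists c'; split=> //; split=> // i le_in.
  exact: (optimal_center_inside x0I c'opt c'incr le_in).
exact: cell_stationary.
Qed.

Lemma optimal_code_unique n x0 : inside a b x0 -> exists c, optimal_code n c /\
  forall c', optimal_code n c' ->
    forall i, (i <= n)%N -> exists2 j, (j <= n)%N & c' i = c j.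
Proof.
move=> x0I; have [c0 /(optimal_stationary x0I)[c [copt cst _]]] := optimal_code_exists n.
exists c; split=> // c' /(optimal_stationary x0I)[c2 [_ c2st c'c2]] i /c'c2[j jn ->].
by exists j => //; exact: stationary_code_unique jn.
Qed.

End logconcave_density.

(** * Transfer between codes and step functions *)

Lemma bigsetU_ordP (T : Type) l (A : 'I_l -> set T) x :
  (\big[setU/set0]_(i < l) A i) x <-> exists i, A i x.
Proof.
split=> [|[i Aix]]; last by rewrite (bigD1 i)//=; left.
by elim/big_ind: _ => [//|S S' hS hS' [/hS|/hS']//|i _ Aix]; exists i.
Qed.

Section transfer.
Context d (T : measurableType d) (R : realType).
Variables (mu : {finite_measure set T -> \bar R}) (p : R).
Hypothesis p1 : 1 <= p.

Lemma ge0_integral_pushforward_density (f : T -> R) (Psi F : R -> R) :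
  measurable_fun setT f -> measurable_fun setT Psi -> (forall x, 0 <= Psi x) ->
  (forall B : set R, measurable B ->
     mu (f @^-1` B) = (\int[lebesgue_measure]_(x in B) (Psi x)%:E)%E) ->
  measurable_fun setT F -> (forall x, 0 <= F x) ->
  (\int[mu]_x (F (f x))%:E = \int[lebesgue_measure]_x (F x * Psi x)%R%:E)%E.
Proof.
move=> mf mPsi Psi0 fE mF F0.
pose f' : T -> measurableTypeR R := f.
have mf' : measurable_fun setT f' by exact: mf.
have mFE : measurable_fun [set: measurableTypeR R] (EFin \o F) by exact/measurable_EFinP.
have F0E x : (0 <= (EFin \o F) x)%E by rewrite lee_fin.
transitivity (\int[pushforward mu f']_x (EFin \o F) x)%E.
  by rewrite (ge0_integral_pushforward mf').
have h := @ge0_integral_density _ (measurableTypeR R) R lebesgue_measure _ Psi mPsi Psi0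
  _ (EFin \o F) mFE F0E.
by rewrite h.
Qed.

Definition power_cost (f g : T -> R) : \bar R := (\int[mu]_x (`|f x - g x| `^ p)%:E)%E.

Lemma power_cost_ge0 f g : (0 <= power_cost f g)%E.
Proof. by apply: integral_ge0 => x _; rewrite lee_fin powR_ge0. Qed.

Lemma LnormE (g : T -> R) :
  Lnorm mu p%:E (EFin \o g) = ((\int[mu]_x (`|g x| `^ p)%:E) `^ p^-1)%E.
Proof. by rewrite unlock; congr poweR; apply: eq_integral => x _; rewrite poweR_EFin. Qed.

Lemma Lnorm_leE f g h :
  (Lnorm mu p%:E (EFin \o (f \- g)%R) <= Lnorm mu p%:E (EFin \o (f \- h)%R))%E <->
  (power_cost f g <= power_cost f h)%E.
Proof.
have p0 : 0 < p by exact: lt_le_trans p1.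
rewrite !LnormE -/(power_cost f g) -/(power_cost f h); split => [le_gh|le_gh].
  have := gt0_ler_poweR (ltW p0) _ _ le_gh; rewrite -!poweRrM mulVf ?gt_eqF//.
  rewrite !poweRe1 ?power_cost_ge0//; apply; rewrite in_itv/= leey andbT; exact: poweR_ge0.
by apply: gt0_ler_poweR => //; rewrite ?invr_ge0 ?ltW// in_itv/= leey andbT power_cost_ge0.
Qed.

Lemma power_integral_fin (g : T -> R) : inLp mu p g ->
  (\int[mu]_x (`|g x| `^ p)%:E < +oo)%E.
Proof.
move=> [_]; rewrite LnormE; apply: lty_poweRy.
by rewrite invr_eq0 gt_eqF// (lt_le_trans _ p1).
Qed.

(** With [values_Gpk], this identifies the class with the measurable functions taking values in a
    code. *)
Lemma Gpk_values n (h : T -> R) : Gpk mu p n.+1 h ->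
  measurable_fun setT h /\
  exists c : nat -> R, forall x, exists2 i, (i <= n)%N & h x = c i.
Proof.
move=> [[mh _] [l [A [a [ln mA dA cA hE]]]]]; split=> //.
(* Indices from [l] on get the default value 0, since a step function may have fewer than [n.+1]
   pieces. *)
exists (fun i => if insub i is Some o then a o else 0) => x.
have : (\big[setU/set0]_(i < l) A i) x by rewrite cA.
move=> /bigsetU_ordP[i Aix].
exists i; first by rewrite -ltnS (leq_trans _ ln).
rewrite valK hE (bigD1 i)//= indicE mem_set// mulr1 big1 ?addr0// => j ji.
rewrite indicE memNset ?mulr0// => Ajx.
by have : (A j `&` A i) x by []; rewrite dA.
Qed.

Lemma values_Gpk n (h : T -> R) (c : nat -> R) : measurable_fun setT h ->
  (forall x, exists2 i, (i <= n)%N & h x = c i) -> Gpk mu p n.+1 h.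
Proof.
move=> mh hc; split.
  split=> //; rewrite LnormE poweR_lty//.
  pose B := \sum_(i < n.+1) `|c i|.
  apply: (@le_lt_trans _ _ (\int[mu]_x (B `^ p)%:E)%E); last first.
    rewrite integral_cst// lte_mul_pinfty ?lee_fin ?powR_ge0//.
    by rewrite ltey_eq fin_num_measure.
  apply: ge0_le_integral => //.
  - apply/measurable_EFinP; apply: (measurableT_comp (measurable_powR p)).
    exact: measurableT_comp.
  move=> x _; rewrite lee_fin ge0_ler_powR ?nnegrE ?sumr_ge0//.
    exact: le_trans p1.
  have [i le_in ->] := hc x.
  by rewrite /B (bigD1 (Ordinal (le_in : (i < n.+1)%N)))//= lerDl sumr_ge0.
(* The partition consists of the level sets of [h]; removing repeated values makes them disjoint. *)
pose s := undup [seq c i | i <- iota 0 n.+1].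
have hs x : h x \in s.
  by have [i le_in ->] := hc x; rewrite mem_undup map_f// mem_iota.
exists (size s), (fun i => h @^-1` [set nth 0 s i]), (fun i => nth 0 s i); split.
- by rewrite (leq_trans (size_undup _))// size_map size_iota.
- by move=> i; rewrite -[X in measurable X]setTI; apply: mh.
- move=> i j ij; apply/seteqP; split=> // x [/= -> /eqP].
  by rewrite nth_uniq ?undup_uniq// => /eqP/val_inj eij; rewrite eij eqxx in ij.
- apply/seteqP; split=> // x _; apply/bigsetU_ordP.
  have := hs x; rewrite -index_mem => lt_s.
  by exists (Ordinal lt_s) => //=; rewrite nth_index.
apply/funext => x; have := hs x; rewrite -index_mem => lt_s.
rewrite (bigD1 (Ordinal lt_s))//= indicE mem_set ?nth_index//= mulr1 big1 ?addr0// => j ji.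
rewrite indicE memNset ?mulr0//= => hxj; case/eqP: ji; apply: val_inj => /=.
by rewrite hxj index_uniq// undup_uniq.
Qed.

End transfer.

Theorem theorem2p8 (d : measure_display) (T : measurableType d) (R : realType)
  (mu : {finite_measure set T -> \bar R}) (p : R) (f : T -> R) (Psi : R -> R) :
  1 <= p ->
  inLp mu p f ->
  (afrak mu f <= bfrak mu f)%E ->
  measurable_fun setT Psi ->
  (forall B : set R, measurable B ->
     mu (f @^-1` B) = (\int[lebesgue_measure]_(x in B) (Psi x)%:E)%E) ->
  (forall x : R, (afrak mu f < x%:E < bfrak mu f)%E -> 0 < Psi x) ->
  (forall x : R, ~ (afrak mu f < x%:E < bfrak mu f)%E -> Psi x = 0) ->
  (forall s : R, (0 < s%:E < bfrak mu f - afrak mu f)%E ->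
     forall y1 y2 : R, (afrak mu f < y1%:E)%E -> y1 <= y2 -> (y2%:E < bfrak mu f)%E ->
       Gs Psi s y2 <= Gs Psi s y1) ->
  [\/ afrak mu f \is a fin_num \/ bfrak mu f \is a fin_num,
      (forall s : R, (0 < s%:E < bfrak mu f - afrak mu f)%E ->
         infinite_set [set Gs Psi s y | y in
                        [set y : R | (afrak mu f < y%:E < bfrak mu f)%E]])
    | continuous Psi] ->
  forall k : nat, (0 < k)%N ->
    exists g : T -> R,
      [/\ Gpk mu p k g,
          (forall h : T -> R, Gpk mu p k h ->
             Lnorm mu p%:E (EFin \o (f \- g)%R) <= Lnorm mu p%:E (EFin \o (f \- h)%R))%E
        & (forall h : T -> R, Gpk mu p k h ->
             (forall h' : T -> R, Gpk mu p k h' ->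
                Lnorm mu p%:E (EFin \o (f \- h)%R) <= Lnorm mu p%:E (EFin \o (f \- h')%R))%E ->
             {ae mu, forall x, h x = g x})].
Proof.
move=> p1 fLp ab mPsi fE Psi_gt0 Psi_eq0 G_mono nondeg [//|n] _.
set a := afrak mu f in ab Psi_gt0 Psi_eq0 G_mono nondeg.
set b := bfrak mu f in ab Psi_gt0 Psi_eq0 G_mono nondeg.
have [mf _] := fLp; have p0 : 0 < p by exact: lt_le_trans p1.
have {}Psi_gt0 x : inside a b x -> 0 < Psi x by exact: Psi_gt0.
have {}Psi_eq0 x : ~~ inside a b x -> Psi x = 0 by move=> /negP; exact: Psi_eq0.
have Psi0 x : 0 <= Psi x.
  by have [/Psi_gt0/ltW//|/Psi_eq0->] := boolP (inside a b x).
have transfer := ge0_integral_pushforward_density mf mPsi Psi0 fE.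
have mPsiE : measurable_fun setT (EFin \o Psi) by exact/measurable_EFinP.
have iPsi : (@lebesgue_measure R).-integrable setT (EFin \o Psi).
  apply/integrableP; split=> //.
  under eq_integral do rewrite /= ger0_norm//.
  rewrite -fE// preimage_setT ltey_eq fin_num_measure//.
have mpow (u : R) : measurable_fun setT (fun x : R => `|x - u| `^ p).
  by apply: (measurableT_comp (measurable_powR p)); exact: measurable_dist.
have iPsip : (@lebesgue_measure R).-integrable setT (EFin \o (fun x => `|x| `^ p * Psi x)).
  have mpow0 : measurable_fun setT (fun x : R => `|x| `^ p).
    by have := mpow 0; under eq_fun do rewrite subr0.
  apply/integrableP; split; first by apply/measurable_EFinP; exact: measurable_funM.
  under eq_integral do rewrite /= ger0_norm ?mulr_ge0 ?powR_ge0//.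
  by rewrite -transfer//; exact: power_integral_fin fLp.
(* With an empty support [Psi] and [mu] vanish, so the distribution function equals both 0 and the
   total mass everywhere; then [a = +oo] and [b = -oo], against [a <= b]. *)
have [x0 x0I] : exists x, inside a b x.
  apply: contrapT => h.
  have Psi00 x : Psi x = 0 by apply: Psi_eq0; apply/negP => xI; apply: h; exists x.
  have mu0 B : measurable B -> mu (f @^-1` B) = 0%E.
    by move=> mB; rewrite fE//; apply: integral0_eq => x _; rewrite Psi00.
  have cdf0 z : Defs.cdf mu f z = 0%E by exact: mu0.
  have muT : mu setT = 0%E by rewrite -(@mu0 setT)// preimage_setT.
  have aE : a = +oo%E.
    rewrite -(@ereal_sup_real R); congr ereal_sup.
    by apply/seteqP; split=> _ [z _ <-]; exists z => //=; exact: cdf0.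
  have bE : b = -oo%E.
    rewrite -(@ereal_inf_real R); congr ereal_inf.
    by apply/seteqP; split=> _ [z _ <-]; exists z => //=; exact: (etrans (cdf0 z) (esym muT)).
  by move: ab; rewrite aE bE.
(* If the smaller product is nonzero, then [x], [y] and [y + s] lie in the support and [s < b - a],
   so denominators can be cleared; otherwise nonnegativity suffices. *)
have Psi_shift : shift_monotone Psi.
  move=> x y s xy s0.
  have Pxs : 0 <= Psi (x + s) * Psi y by rewrite mulr_ge0.
  have [xI|/Psi_eq0 ->] := boolP (inside a b x); last by rewrite mulr0.
  have [ysI|/Psi_eq0 ->] := boolP (inside a b (y + s)); last by rewrite mul0r.
  move: s0; rewrite le_eqVlt => /predU1P[<-|s0]; first by rewrite !addr0 mulrC.
  have yI : inside a b y.
    by apply: inside_between xI ysI _; rewrite xy lerDl ltW.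
  have sab : (0 < s%:E < b - a)%E.
    rewrite lte_fin s0/=.
    have [ax _] := andP xI; have [_ ysb] := andP ysI.
    move: ax ysb; case: (a) => [ra| |]; case: (b) => [rb| |]//=; rewrite ?ltry//.
    by rewrite -EFinB !lte_fin; lra.
  have [ax _] := andP xI; have [_ yb] := andP yI.
  have := G_mono s sab x y ax xy yb.
  by rewrite /Gs ler_pdivrMr ?Psi_gt0// mulrAC ler_pdivlMr ?Psi_gt0.
have [c [copt cuniq]] := optimal_code_unique p1 mPsi Psi_gt0 Psi_eq0 Psi_shift iPsi iPsip
  nondeg n x0I.
have distE c' : distortion Psi p n c' = (\int[mu]_x (code_dist n c' (f x) `^ p)%:E)%E.
  have mc : measurable_fun setT (fun x : R => code_dist n c' x `^ p).
    exact: (measurableT_comp (measurable_powR p) (measurable_code_dist n c')).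
  by rewrite (transfer _ mc)// => x; exact: powR_ge0.
have mcost (h : T -> R) : measurable_fun setT h -> measurable_fun setT (fun x : T => `|f x - h x| `^ p).
  move=> mh; apply: (measurableT_comp (measurable_powR p)).
  by apply: measurableT_comp => //; exact: measurable_funB.
have mcode c' : measurable_fun setT (fun x : T => code_dist n c' (f x) `^ p).
  apply: (measurableT_comp (measurable_powR p)).
  exact: (measurableT_comp (measurable_code_dist n c')).
have dist_le c' (h : T -> R) x : (forall x, exists2 i, (i <= n)%N & h x = c' i) ->
    code_dist n c' (f x) `^ p <= `|f x - h x| `^ p.
  move=> hc'; rewrite ge0_ler_powR ?nnegrE ?code_dist_ge0// ?(ltW p0)//.
  by have [i le_in ->] := hc' x; exact: code_dist_le.
have costE c' (h : T -> R) : measurable_fun setT h -> (forall x, exists2 i, (i <= n)%N & h x = c' i) ->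
    (distortion Psi p n c' <= power_cost mu p f h)%E.
  move=> mh hc'; rewrite distE; apply: ge0_le_integral => //.
  - by move=> x _; rewrite lee_fin powR_ge0.
  - by apply/measurable_EFinP; exact: mcode.
  - by apply/measurable_EFinP; exact: mcost.
  - by move=> x _; rewrite lee_fin dist_le.
pose g := nearest n c \o f.
have mg : measurable_fun setT g by exact: (measurableT_comp (measurable_nearest n c)).
have gc x : exists2 i, (i <= n)%N & g x = c i by exact: nearest_in.
have gcost : power_cost mu p f g = distortion Psi p n c.
  by rewrite distE; apply: eq_integral => x _; rewrite dist_nearest.
have gG : Gpk mu p n.+1 g by exact: (values_Gpk mu p1 mg gc).
exists g; split=> //.
  move=> h /Gpk_values[mh [c' hc']]; apply/(Lnorm_leE mu p1).
  by rewrite gcost; exact: le_trans (copt c') (costE c' h mh hc').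
move=> h /Gpk_values[mh [c' hc']] hopt.
have hg : (power_cost mu p f h <= power_cost mu p f g)%E.
  by apply/(Lnorm_leE mu p1); exact: hopt.
(* The values of a minimizer form an optimal code, hence lie in [c]; [g] is then pointwise at least
   as close to [f], and equality of the costs forces equal distances almost everywhere. *)
have c'opt : optimal_code Psi p n c'.
  move=> c2; apply: le_trans (copt c2); rewrite -gcost.
  exact: le_trans (costE c' h mh hc') hg.
have hc x : exists2 i, (i <= n)%N & h x = c i.
  by have [i le_in ->] := hc' x; exact: cuniq.
have g_fin : (power_cost mu p f g < +oo)%E.
  rewrite gcost ltey_eq; apply/orP; left.
  exact: (distortion_fin_num p1 mPsi Psi_gt0 Psi_eq0 iPsi iPsip).
have icost (h' : T -> R) : measurable_fun setT h' -> (power_cost mu p f h' < +oo)%E ->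
    mu.-integrable setT (EFin \o (fun x => `|f x - h' x| `^ p)).
  move=> mh' fin; apply/integrableP; split; first by apply/measurable_EFinP; exact: mcost.
  by under eq_integral do rewrite /= ger0_norm ?powR_ge0//.
have eq_cost : {ae mu, forall x, `|f x - g x| `^ p = `|f x - h x| `^ p}.
  apply: (le_integral_ae_eq _ _ _ hg).
  - exact: icost.
  - by apply: icost => //; exact: le_lt_trans hg g_fin.
  - by move=> x; rewrite /g /= dist_nearest dist_le.
(* Distinct values [g x] and [h x] at equal distance from [f x] put [f x] at a midpoint of code
   points; this finite set is null for a distribution with a density. *)
pose M := [set (c i + c j) / 2 | i in `I_n.+1 & j in `I_n.+1].
have countM : countable M.
  by apply: finite_set_countable; apply: finite_image2; exact: finite_II.
have mM : measurable M by exact: countable_measurable.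
have muM : mu (f @^-1` M) = 0%E.
  rewrite fE// null_set_integral//; first exact: measurable_funTS.
  exact: countable_lebesgue_measure0.
have offM : {ae mu, forall x, ~ M (f x)}.
  exists (f @^-1` M); split=> //.
    by rewrite -[X in measurable X]setTI; exact: mf.
  by move=> x /=; exact: contrapT.
apply: filterS2 eq_cost offM => x.
move=> /(powR_injective p0); rewrite !nnegrE => /(_ (normr_ge0 _) (normr_ge0 _)).
have [i le_in ->] := gc x; have [j jn ->] := hc x => eq_d nM.
apply/eqP; apply: contraT => ji; case: nM.
exists i; first by rewrite /= ltnS.
exists j; first by rewrite /= ltnS.
have /eqP : (f x - c i) ^+ 2 = (f x - c j) ^+ 2.
  by rewrite -[LHS]real_normK ?num_real// eq_d real_normK ?num_real.
rewrite eqf_sqr => /orP[/eqP e|/eqP e]; last by lra.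
by case/eqP: ji; lra.
Qed.
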